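(* Let $A,B$ be two solid, closed, convex sets in $\mathbb{R}^n$, and let $x^*\in A\cap B$ be the limit point of the sequence $(x_k)$ generated by the GAP algorithm $x_{k+1}=(1-\alpha)x_k+\alpha\Pi_A^{\alpha_2}\Pi_B^{\alpha_1}x_k$. Assume that $x^*\in\operatorname{bd}A\cap\operatorname{bd}B$ and that $(\operatorname{bd}A,\operatorname{bd}B)$ satisfy the regularity assumption at $x^*$. Then the sets are $\hat\kappa$-linearly regular at $x^*$, i.e. there exist $\delta>0$ and $\hat\kappa>0$ with $$d_{A\cap B}(x)\le\hat\kappa\max(d_A(x),d_B(x))\quad\forall x\in\mathcal{B}_\delta(x^* ).$$ Let $\kappa$ be the infimum of all such $\hat\kappa$ and assume $\kappa\ge\sqrt2$. Then the GAP algorithm with parameters $$\alpha=1,\quad\alpha_1=\alpha_2=2\left(\frac{\kappa}{\sqrt{\kappa^2-1}+1}\right)^2$$ converges to $x^*$ R-linearly with rate $\mu$ for any $\mu\in(\gamma,1)$, where $$\gamma=\left(\frac{\sqrt{\kappa^2-1}-1}{\sqrt{\kappa^2-1}+1}\right)^2=1-4\frac{\sqrt{\kappa^2-1}}{\kappa^2+2\sqrt{\kappa^2-1}}.$$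
   Context: Solid means nonempty interior; $\Pi_C$ is the projection onto $C$, $\Pi_C^\alpha:=(1-\alpha)I+\alpha\Pi_C$; $d_C$ is the distance to $C$; $\mathcal{B}_\delta(x)$ is the closed ball. A set $\mathcal{M}$ is a $\mathcal{C}^k$-manifold around $x$ if there is an open $U\ni x$ with $\mathcal{M}\cap U=\{y:F(y)=0\}$ for a $\mathcal{C}^k$ map $F:U\to\mathbb{R}^d$ with surjective derivative throughout $U$; $T_{\mathcal{M}}(x)=\ker DF(x)$. Regularity assumption at $x$: $\mathcal{M},\mathcal{N}$ are $\mathcal{C}^k$-smooth ($k\ge2$) around $x\in\mathcal{M}\cap\mathcal{N}$, $\mathcal{M}\cap\mathcal{N}$ is a $\mathcal{C}^k$ manifold around $x$, and $T_{\mathcal{M}\cap\mathcal{N}}(x)=T_{\mathcal{M}}(x)\cap T_{\mathcal{N}}(x)$. R-linear convergence with rate $\mu$: there is $C>0$ with $\|x_k-x^*\|\le C\mu^k$ for all $k$. *)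

(* Defs.v *)
From HB Require Import structures.
From mathcomp Require Import all_boot all_order all_algebra.
From mathcomp Require Import all_classical all_reals all_analysis.
Set Implicit Arguments. Unset Strict Implicit. Unset Printing Implicit Defensive.
Import Order.TTheory GRing.Theory Num.Theory.
Import numFieldNormedType.Exports.
Local Open Scope classical_set_scope.
Local Open Scope ring_scope.

Section GAPDefs.
Variable R : realType.

(* Euclidean norm on R^n (row vectors); the library's norm on 'rV is the
   sup-norm, which induces the same topology but not the same projections. *)
Definition enorm (n : nat) (v : 'rV[R]_n) : R :=
  Num.sqrt (\sum_(i < n) (v ord0 i) ^+ 2).

Definition solid (n : nat) (C : set 'rV[R]_n) : Prop := interior C !=set0.

Definition bd (n : nat) (C : set 'rV[R]_n) : set 'rV[R]_n :=
  closure C `\` interior C.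

Definition dist (n : nat) (C : set 'rV[R]_n) (x : 'rV[R]_n) : R :=
  inf [set enorm (x - y) | y in C].

(* Euclidean projection onto C (a nearest point; unique for nonempty
   closed convex C) *)
Definition proj (n : nat) (C : set 'rV[R]_n) (x : 'rV[R]_n) : 'rV[R]_n :=
  xget x [set p | C p /\ forall y, C y -> enorm (x - p) <= enorm (x - y)].

Definition rproj (n : nat) (a : R) (C : set 'rV[R]_n) (x : 'rV[R]_n) :=
  (1 - a) *: x + a *: proj C x.

Definition gap_step (n : nat) (al al1 al2 : R) (A B : set 'rV[R]_n)
  (x : 'rV[R]_n) : 'rV[R]_n :=
  (1 - al) *: x + al *: rproj al2 A (rproj al1 B x).

Fixpoint Ck (n d : nat) (k : nat) (U : set 'rV[R]_n)
  (f : 'rV[R]_n -> 'rV[R]_d) {struct k} : Prop :=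
  match k with
  | 0 => forall y, U y -> {for y, continuous f}
  | k'.+1 => (forall y, U y -> {for y, continuous f}) /\
             (forall y v, U y -> derivable f y v) /\
             (forall v, Ck k' U ('D_v f))
  end.

Definition local_chart (n d k : nat) (M : set 'rV[R]_n) (x : 'rV[R]_n)
  (U : set 'rV[R]_n) (F : 'rV[R]_n -> 'rV[R]_d) : Prop :=
  [/\ open U, U x, Ck k U F,
      (forall y, U y -> forall w : 'rV[R]_d, exists v, 'd F y v = w) &
      M `&` U = [set y | U y /\ F y = 0]].

Definition tangent_via (n d : nat) (F : 'rV[R]_n -> 'rV[R]_d)
  (x : 'rV[R]_n) : set 'rV[R]_n := [set v | 'd F x v = 0].

Definition regularity_assumption (n : nat) (M N : set 'rV[R]_n)
  (x : 'rV[R]_n) : Prop :=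
  M x /\ N x /\
  exists k : nat, (2 <= k)%N /\
  exists (dM dN dMN : nat) (UM UN UMN : set 'rV[R]_n)
         (FM : 'rV[R]_n -> 'rV[R]_dM) (FN : 'rV[R]_n -> 'rV[R]_dN)
         (FMN : 'rV[R]_n -> 'rV[R]_dMN),
    [/\ local_chart k M x UM FM, local_chart k N x UN FN,
        local_chart k (M `&` N) x UMN FMN &
        tangent_via FMN x = tangent_via FM x `&` tangent_via FN x].

Definition lin_regular_with (n : nat) (A B : set 'rV[R]_n)
  (xs : 'rV[R]_n) (kh : R) : Prop :=
  0 < kh /\ exists delta : R, 0 < delta /\
    forall x, enorm (x - xs) <= delta ->
      dist (A `&` B) x <= kh * Num.max (dist A x) (dist B x).

Definition reg_kappa (n : nat) (A B : set 'rV[R]_n) (xs : 'rV[R]_n) : R :=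
  inf [set kh | lin_regular_with A B xs kh].

Definition gap_alpha (kappa : R) : R :=
  2 * (kappa / (Num.sqrt (kappa ^+ 2 - 1) + 1)) ^+ 2.

Definition gap_gamma (kappa : R) : R :=
  ((Num.sqrt (kappa ^+ 2 - 1) - 1) / (Num.sqrt (kappa ^+ 2 - 1) + 1)) ^+ 2.

End GAPDefs.

(* Main.v *)
Require Import Defs.
From HB Require Import structures.
From mathcomp Require Import all_boot all_order all_algebra.
From mathcomp Require Import all_classical all_reals all_analysis.
From mathcomp Require Import ring lra.
Import Order.TTheory GRing.Theory Num.Theory.
Import numFieldNormedType.Exports.
Local Open Scope classical_set_scope.
Local Open Scope ring_scope.

(** Outside a convex set whose boundary is smooth at [xs], the directions
    [x - proj x] have a single limit as [x] tends to [xs], the normal of the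
    chart.  With [c] the inner product of the two normals, the regularity
    modulus is [sqrt (2 / (1 + c))] when [c > -1]; when [c = -1] the two
    boundaries coincide with a hyperplane near [xs] and the modulus is at
    most 1.

    Write [v_k] and [u_k] for the distances that the two successive
    projections of step [k] travel.  Over-relaxation pushes points into the set,
    so either the sequence is eventually constant or all these distances are
    positive, and then the variational inequalities give
    [v_(k+1) = - (a - 1) v_k - a c u_k + o(v_k + u_k)] and
    [u_(k+1) = - (a - 1) u_k - a c v_(k+1) + o(u_k + v_(k+1))].
    At the stated parameter this linear recursion has the double eigenvalue
    [a - 1 = gamma], so the step lengths, and with them the distance to the
    limit, are [O(mu^k)] for every [mu > gamma]. *)

Set Implicit Arguments.
Unset Strict Implicit.
Unset Printing Implicit Defensive.

(** * Euclidean inner product, norm and topology of row vectors *)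

Section Euclidean.
Variables (R : realType) (n : nat).
Implicit Types (u v w : 'rV[R]_n) (a : R).

Definition dot u v : R := \sum_(i < n) u ord0 i * v ord0 i.

Lemma dotC u v : dot u v = dot v u.
Proof. by apply: eq_bigr => i _; rewrite mulrC. Qed.

Lemma dotDl u v w : dot (u + v) w = dot u w + dot v w.
Proof. by rewrite -big_split; apply: eq_bigr => i _; rewrite mxE mulrDl. Qed.

Lemma dotZl a u w : dot (a *: u) w = a * dot u w.
Proof. by rewrite /dot mulr_sumr; apply: eq_bigr => i _; rewrite mxE mulrA. Qed.

Lemma dotNl u w : dot (- u) w = - dot u w.
Proof. by rewrite -scaleN1r dotZl mulN1r. Qed.

Lemma dotDr u v w : dot w (u + v) = dot w u + dot w v.
Proof. by rewrite dotC dotDl !(dotC _ w). Qed.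

Lemma dotZr a u w : dot w (a *: u) = a * dot w u.
Proof. by rewrite dotC dotZl dotC. Qed.

Lemma dotNr u w : dot w (- u) = - dot w u.
Proof. by rewrite dotC dotNl dotC. Qed.

Lemma dot0r w : dot w 0 = 0.
Proof. by rewrite -(scale0r w) dotZr mul0r. Qed.

Definition dotE := (dotDl, dotDr, dotNl, dotNr, dotZl, dotZr).

Lemma dotvv_ge0 v : 0 <= dot v v.
Proof. by apply: sumr_ge0 => i _; rewrite -expr2 sqr_ge0. Qed.

Lemma enormE v : enorm v = Num.sqrt (dot v v).
Proof. by rewrite /enorm; congr Num.sqrt; apply: eq_bigr => i _; rewrite expr2. Qed.

Lemma enorm_ge0 v : 0 <= enorm v.
Proof. exact: sqrtr_ge0. Qed.

Lemma enorm_sqr v : enorm v ^+ 2 = dot v v.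
Proof. by rewrite enormE sqr_sqrtr ?dotvv_ge0. Qed.

Lemma enorm_eq0 v : enorm v = 0 -> v = 0.
Proof.
move=> v0; have : dot v v = 0 by rewrite -enorm_sqr v0 expr0n.
move/eqP; rewrite psumr_eq0; last by move=> i _; rewrite -expr2 sqr_ge0.
move=> /allP h; apply/rowP => i; rewrite mxE; apply/eqP.
by have := h i (mem_index_enum i); rewrite /= -expr2 sqrf_eq0.
Qed.

Lemma enorm0 : enorm (0 : 'rV[R]_n) = 0.
Proof. by rewrite enormE dot0r sqrtr0. Qed.

Lemma enormZ a v : enorm (a *: v) = `|a| * enorm v.
Proof. by rewrite !enormE dotZl dotZr mulrA -expr2 sqrtrM ?sqr_ge0// sqrtr_sqr. Qed.

Lemma enormN v : enorm (- v) = enorm v.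
Proof. by rewrite -scaleN1r enormZ normrN1 mul1r. Qed.

Lemma enormB u v : enorm (u - v) = enorm (v - u).
Proof. by rewrite -enormN opprB. Qed.

Lemma dot_le u v : dot u v <= enorm u * enorm v.
Proof.
have [/enorm_eq0 ->|v0] := eqVneq (enorm v) 0.
  by rewrite dot0r enorm0 mulr0.
have [/enorm_eq0 ->|u0] := eqVneq (enorm u) 0.
  by rewrite dotC dot0r enorm0 mul0r.
have up : 0 < enorm u by rewrite lt_neqAle eq_sym u0 enorm_ge0.
have vp : 0 < enorm v by rewrite lt_neqAle eq_sym v0 enorm_ge0.
have := dotvv_ge0 (enorm v *: u - enorm u *: v).
rewrite !dotE -!enorm_sqr (dotC v u) => h.
have : 0 <= 2 * (enorm u * enorm v) * (enorm u * enorm v - dot u v) by nra.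
by rewrite pmulr_rge0 ?subr_ge0// mulr_gt0// mulr_gt0.
Qed.

Lemma ndot_le u v : `|dot u v| <= enorm u * enorm v.
Proof.
by rewrite ler_norml dot_le andbT lerNl -dotNl (le_trans (dot_le _ _))// enormN.
Qed.

Lemma enormD u v : enorm (u + v) <= enorm u + enorm v.
Proof.
have h : 0 <= enorm u + enorm v by rewrite addr_ge0 ?enorm_ge0.
rewrite -(@ler_pXn2r _ 2) ?nnegrE ?enorm_ge0//.
rewrite enorm_sqr !dotE sqrrD !enorm_sqr (dotC v u).
have := dot_le u v; lra.
Qed.

Lemma enorm_tri u v w : enorm (u - w) <= enorm (u - v) + enorm (v - w).
Proof. by rewrite (le_trans _ (enormD _ _))// addrA subrK. Qed.

Lemma norm_coord v i : `|v ord0 i| <= `|v|.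
Proof.
rewrite [leRHS]/Num.norm /= mx_normrE; apply/bigmax_geP; right => /=.
by exists (ord0, i).
Qed.

Lemma norm_le_enorm v : `|v| <= enorm v.
Proof.
rewrite [leLHS]/Num.norm /= mx_normrE; apply/bigmax_leP; split; first exact: enorm_ge0.
move=> [j i] _ /=; rewrite (ord1 j) -sqrtr_sqr ler_sqrt; last first.
  by apply: sumr_ge0 => k _; rewrite sqr_ge0.
by rewrite (bigD1 i)//= lerDl sumr_ge0// => k _; rewrite sqr_ge0.
Qed.

Lemma enorm_le_norm v : enorm v <= (n%:R + 1) * `|v|.
Proof.
have h : 0 <= (n%:R + 1) * `|v| by rewrite mulr_ge0// addr_ge0.
rewrite -(@ler_pXn2r _ 2) ?nnegrE ?enorm_ge0// enorm_sqr.
have : dot v v <= n%:R * `|v| ^+ 2.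
  have -> : n%:R * `|v| ^+ 2 = \sum_(i < n) `|v| ^+ 2.
    by rewrite sumr_const card_ord mulr_natl.
  apply: ler_sum => i _; rewrite -expr2 -real_normK ?num_real//.
  by rewrite ler_pXn2r ?nnegrE//; exact: norm_coord.
move=> /le_trans; apply; rewrite exprMn ler_wpM2r ?sqr_ge0//.
have := ler0n R n; nra.
Qed.

(** The library topology comes from the sup-norm; each norm bounds a multiple of the other, so
    Euclidean balls form a neighbourhood basis. *)
Lemma nbhs_enormP (P : set 'rV[R]_n) v :
  nbhs v P <-> exists2 d, 0 < d & forall w, enorm (w - v) <= d -> P w.
Proof.
have n1 : 0 < (n%:R + 1 : R) by rewrite ltr_pwDr.
split.
  move=> /nbhs_ballP[e /= e0 h]; exists (e / 2); first by rewrite divr_gt0.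
  move=> w wv; apply: h; rewrite mx_norm_ball /ball_ /=.
  rewrite distrC (le_lt_trans (norm_le_enorm _))// (le_lt_trans wv)//.
  by rewrite ltr_pdivrMr// ltr_pMr// ltr1n.
move=> [d d0 h]; apply/nbhs_ballP; exists (d / (n%:R + 1)) => /=.
  by rewrite divr_gt0.
move=> w; rewrite mx_norm_ball /ball_ /= => vw; apply: h.
by rewrite enormB (le_trans (enorm_le_norm _))// mulrC -ler_pdivlMr// ltW.
Qed.

Lemma enorm_continuous : continuous (@enorm R n).
Proof.
move=> v P /nbhs_ballP[e /= e0 h]; apply/nbhs_enormP.
exists (e / 2) => [|w]; first by rewrite divr_gt0.
rewrite enormB => vw; apply: h => /=.
have {}vw : enorm (v - w) < e.
  by rewrite (le_lt_trans vw)// ltr_pdivrMr// ltr_pMr// ltr1n.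
rewrite /ball /= (le_lt_trans _ vw)// ler_norml; apply/andP; split.
  by rewrite lerNl opprB lerBlDr addrC enormB -{1}(subrK v w) addrC enormD.
by rewrite lerBlDr -{1}(subrK w v) enormD.
Qed.

Lemma closure_enormP (A : set 'rV[R]_n) v :
  closure A v <-> forall e, 0 < e -> exists2 a, A a & enorm (a - v) <= e.
Proof.
split=> [clv e e0|h P /nbhs_enormP[e e0 eP]].
  have [|a [Aa /= va]] := clv [set a | enorm (a - v) <= e].
    by apply/nbhs_enormP; exists e.
  by exists a.
by have [a Aa av] := h _ e0; exists a; split=> //; exact: eP.
Qed.

Lemma enorm_closed_le w (d : R) : closed [set v | enorm (v - w) <= d].
Proof.
move=> v /closure_enormP clv /=; rewrite leNgt; apply/negP => dv.
have [|a /= ad av] := clv ((enorm (v - w) - d) / 2).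
  by rewrite divr_gt0// subr_gt0.
have := enorm_tri v a w; rewrite (enormB v a); lra.
Qed.

Lemma enorm_compact (K : set 'rV[R]_n) (M : R) :
  closed K -> (forall v, K v -> enorm v <= M) -> compact K.
Proof.
move=> cK bK; apply: bounded_closed_compact => //.
exists M; split; first exact: num_real.
by move=> r Mr v /bK vM; apply: le_trans (ltW Mr); apply: le_trans vM; exact: norm_le_enorm.
Qed.

(** Compactness of the unit sphere, phrased with recurring indices so that no subsequence has to be
    extracted. *)
Lemma sphere_cluster (f : nat -> 'rV[R]_n) : (forall k, enorm (f k) = 1) ->
  exists2 v, enorm v = 1 &
    forall e, 0 < e -> forall N, exists2 k, (N <= k)%N & enorm (f k - v) <= e.
Proof.
move=> f1; pose K := [set v : 'rV[R]_n | enorm v = 1].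
have cK : compact K.
  apply: (@enorm_compact _ 1); last by move=> v /= ->.
  move=> v /closure_enormP clv; apply/eqP; rewrite eq_le.
  apply/andP; split; rewrite leNgt; apply/negP => lt1.
    have [|a a1 av] := clv ((enorm v - 1) / 2); first by rewrite divr_gt0// subr_gt0.
    have := enormD (v - a) a; rewrite subrK enormB a1; lra.
  have [|a a1 av] := clv ((1 - enorm v) / 2); first by rewrite divr_gt0// subr_gt0.
  have := enormD (a - v) v; rewrite subrK a1; lra.
have [] := cK (f @ \oo) _.
  by exists 0%N => // k _; exact: f1.
move=> v [Kv clv]; exists v => // e e0 N.
have [] := clv (f @` [set k | (N <= k)%N]) [set w | enorm (w - v) <= e].
- by exists N => // k Nk; exists k.
- by apply/nbhs_enormP; exists e.
by move=> _ [[k Nk <-] ?]; exists k.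
Qed.

End Euclidean.

(** * Projections onto closed convex sets *)

Local Notation proj := Defs.proj.

Lemma convex_comb (R : realType) n (A : set 'rV[R]_n) : convex_set A ->
  forall t x y, A x -> A y -> 0 <= t <= 1 -> A (t *: x + (1 - t) *: y).
Proof.
move=> cA t x y Ax Ay t01.
have ts : Itv.spec (@Itv.num_sem R) (Itv.Real `[0%Z, 1%Z]) t.
  by rewrite /Itv.spec /= /Itv.num_sem/= in_itv/= num_real.
by have := cA x y (Itv.mk ts); rewrite !inE => /(_ Ax Ay).
Qed.

Section Projection.
Variables (R : realType) (n : nat) (A : set 'rV[R]_n).
Hypotheses (A0 : A !=set0) (clA : closed A).
Implicit Types (x y p : 'rV[R]_n).

Lemma proj_spec x : A (proj A x) /\
  forall y, A y -> enorm (x - proj A x) <= enorm (x - y).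
Proof.
suff /(xgetPex x) : exists p, [set p | A p /\
  forall y, A y -> enorm (x - p) <= enorm (x - y)] p by [].
case: A0 => a Aa.
(* Only points at least as close as [a] can compete, so the minimum is sought on a compact piece of
   [A]. *)
pose K := A `&` [set v | enorm (v - x) <= enorm (x - a)].
have [|||c] := @EVT_min_rV R n (fun y => enorm (x - y)) K.
- by exists a; split=> //=; rewrite enormB.
- apply: (@enorm_compact _ _ _ (enorm (x - a) + enorm x)).
    by apply: closedI => //; exact: enorm_closed_le.
  move=> v [_ /= vx]; rewrite -(subrK x v) (le_trans (enormD _ _))//.
  by rewrite lerD2r.
- apply: continuous_subspaceT => y.
  apply: continuous_comp; last exact: enorm_continuous.
  by apply: continuousB; [exact: cst_continuous|by move=> ?; exact: cvg_id].
rewrite inE => -[Ac cx] cmin; exists c; split=> // y Ay.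
have [ya|/ltW ay] := leP (enorm (x - y)) (enorm (x - a)).
  apply: cmin; apply/mem_set; split=> //=.
  by rewrite (enormB y).
by move: cx => /=; rewrite (enormB c) => /le_trans; apply.
Qed.

Lemma projP x : A (proj A x).
Proof. by have [] := proj_spec x. Qed.

Lemma proj_id x : A x -> proj A x = x.
Proof.
move=> Ax; have [_ /(_ x Ax)] := proj_spec x; rewrite subrr enorm0 => h.
apply/esym/eqP; rewrite -subr_eq0; apply/eqP/enorm_eq0/eqP.
by rewrite eq_le h enorm_ge0.
Qed.

Lemma distE x : dist A x = enorm (x - proj A x).
Proof.
have [Ap pmin] := proj_spec x; apply/eqP; rewrite eq_le; apply/andP; split.
  apply: ge_inf; last by exists (proj A x).
  by exists 0 => _ [y _ <-]; exact: enorm_ge0.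
apply: lb_le_inf; first by exists (enorm (x - proj A x)); exists (proj A x).
by move=> _ [y Ay <-]; exact: pmin.
Qed.

Lemma dist_ge0 x : 0 <= dist A x.
Proof. by rewrite distE enorm_ge0. Qed.

Lemma dist_le x y : A y -> dist A x <= enorm (x - y).
Proof. by rewrite distE; have [_] := proj_spec x; apply. Qed.

Lemma dist_gt0 x : ~ A x -> 0 < dist A x.
Proof.
move=> nAx; rewrite lt_neqAle dist_ge0 andbT; apply/eqP; rewrite distE => /esym.
by move=> /enorm_eq0/subr0_eq xp; apply: nAx; rewrite xp; exact: projP.
Qed.

Hypothesis cvA : convex_set A.

Lemma proj_var x y : A y -> dot (x - proj A x) (y - proj A x) <= 0.
Proof.
move=> Ay; have [Ap pmin] := proj_spec x; set p := proj A x in Ap pmin *.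
rewrite leNgt; apply/negP => d0.
set d := dot _ _ in d0; set q := dot (y - p) (y - p).
have q0 : 0 <= q by exact: dotvv_ge0.
(* Moving from [p] towards [y] by [t] changes the squared distance by [- 2 t d + t^2 q], which is
   negative since [t q < d]; this form of [t] stays in [[0, 1]] even when [q = 0]. *)
pose t := d / (d + q).
have dq : 0 < d + q by lra.
have t01 : 0 <= t <= 1.
  by rewrite /t divr_ge0 ?(ltW d0) ?(ltW dq)//= ler_pdivrMr// mul1r; lra.
have := pmin _ (convex_comb cvA Ay Ap t01).
rewrite -(@ler_pXn2r _ 2) ?nnegrE ?enorm_ge0// !enorm_sqr.
have -> : x - (t *: y + (1 - t) *: p) = (x - p) - t *: (y - p).
  by rewrite scalerBr scalerBl scale1r; apply/rowP => i; rewrite !mxE; ring.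
have -> : dot (x - p - t *: (y - p)) (x - p - t *: (y - p)) =
    dot (x - p) (x - p) - 2 * t * d + t ^+ 2 * q.
  rewrite /d /q; move: (x - p) (y - p) => z w.
  by rewrite !dotE (dotC w z); ring.
have tq : t * (d + q) = d by rewrite /t divfK// gt_eqF.
have t0 : 0 < t by rewrite /t divr_gt0.
nra.
Qed.

(** Adding the variational inequalities at [x] and [y] gives [|p - q|^2 <= <p - q, x - y>];
    Cauchy-Schwarz concludes. *)
Lemma proj_nonexp x y : enorm (proj A x - proj A y) <= enorm (x - y).
Proof.
have hx := proj_var x (projP y); have hy := proj_var y (projP x).
set p := proj A x in hx hy *; set q := proj A y in hx hy *.
have [->|pq] := eqVneq (enorm (p - q)) 0; first exact: enorm_ge0.
have pq0 : 0 < enorm (p - q) by rewrite lt_neqAle eq_sym pq enorm_ge0.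
rewrite -(ler_pM2l pq0) -expr2 enorm_sqr (le_trans _ (dot_le _ _))//.
suff -> : dot (p - q) (p - q) = dot (p - q) (x - y)
    + dot (x - p) (q - p) + dot (y - q) (p - q) by lra.
by move: p q {hx hy pq pq0} => p q; rewrite !dotE (dotC q p) (dotC x p) (dotC x q)
  (dotC y p) (dotC y q); ring.
Qed.

(* Zero when [x] lies in [A], since [0^-1 = 0]. *)
Definition unormal x : 'rV[R]_n := (dist A x)^-1 *: (x - proj A x).

Lemma unormalE x : ~ A x -> x - proj A x = dist A x *: unormal x.
Proof. by move=> /dist_gt0 d0; rewrite scalerA divff ?scale1r// gt_eqF. Qed.

Lemma enorm_unormal x : ~ A x -> enorm (unormal x) = 1.
Proof.
move=> /dist_gt0 d0; rewrite enormZ -distE gtr0_norm ?invr_gt0//.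
by rewrite mulVf// gt_eqF.
Qed.

Lemma unormal_le x y : A y -> dot (unormal x) (y - proj A x) <= 0.
Proof.
by move=> Ay; rewrite dotZl mulr_ge0_le0 ?proj_var// invr_ge0 dist_ge0.
Qed.

End Projection.

(** * Boundary charts and normals *)

Lemma le0_epsP (R : realType) (x K : R) : (forall e, 0 < e -> x <= e * K) -> x <= 0.
Proof.
move=> h; rewrite leNgt; apply/negP => x0.
have K1 : 0 < `|K| + 1 by rewrite ltr_wpDl.
have := h (x / (2 * (`|K| + 1))); rewrite divr_gt0// ?mulr_gt0// => /(_ isT).
apply/negP; rewrite -ltNge (@le_lt_trans _ _ (x / (2 * (`|K| + 1)) * (`|K| + 1)))//.
  by rewrite ler_wpM2l// ?divr_ge0 ?ltW ?mulr_gt0// (le_lt_trans (ler_norm _))// ltrDl.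
by rewrite invfM mulrA divfK ?gt_eqF// ltr_pdivrMr// ltr_pMr// ltr1n.
Qed.

(** Since [F xs = 0], this is the Taylor expansion of order one. [Ck] speaks of directional
    derivatives only, so total differentiability at [xs] is decided by cases, and surjectivity of
    the derivative settles the degenerate one. *)
Lemma chart_first_order (R : realType) n d k (M : set 'rV[R]_n) xs U
    (F : 'rV[R]_n -> 'rV[R]_d) : local_chart k M xs U F -> M xs ->
  forall e, 0 < e -> exists2 r, 0 < r & forall h, enorm h <= r ->
    U (xs + h) /\ `|F (xs + h) - 'd F xs h| <= e * enorm h.
Proof.
move=> [oU Uxs _ surjF MU] Mxs e e0.
have F0 : F xs = 0.
  by have [] : [set y | U y /\ F y = 0] xs by rewrite -MU.
have nU : nbhs (0 : 'rV[R]_n) [set h | U (xs + h)].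
  have /nbhs_enormP[r r0 rU] : nbhs xs U by exact: open_nbhs_nbhs.
  apply/nbhs_enormP; exists r => // w; rewrite subr0 => wr; apply: rU.
  by rewrite addrC addKr.
suff nF : nbhs (0 : 'rV[R]_n)
    [set h | `|F (xs + h) - F xs - 'd F xs h| <= e * `|h|].
  have nUF : nbhs (0 : 'rV[R]_n) ([set h | U (xs + h)] `&`
      [set h | `|F (xs + h) - F xs - 'd F xs h| <= e * `|h|]) by exact: filterI.
  have [r r0 rP] := iffLR (nbhs_enormP _ _) nUF.
  exists r => // h hr; have [] := rP h; first by rewrite subr0.
  rewrite /= F0 subr0 => Uh Fh; split=> //; apply: le_trans Fh _.
  by rewrite ler_wpM2l ?norm_le_enorm// ltW.
have [/diff_locallyxC dF|ndF] := pselect (differentiable F xs).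
  have /eqaddoP/(_ e e0) : (fun h => F (xs + h)) =
      (fun h => F xs + 'd F xs h) +o_ (0 : 'rV[R]_n) id.
    by apply/funext => h; exact: dF.
  apply: filterS => h /=.
  rewrite [X in `|X|](_ : _ = F (xs + h) - F xs - 'd F xs h)//.
  by rewrite -addrA -opprD.
(* A non-differentiable [F] has the zero map as ['d F], which is onto only
   when the target is trivial. *)
have dF0 y : 'd F xs y = 0.
  rewrite /diff; case: xgetP => [df dfE [c H]|_]; last by [].
  by exfalso; apply: ndF; apply/diffP; rewrite /diff -dfE.
have W0 (w : 'rV[R]_d) : w = 0.
  by have [v <-] := surjF _ Uxs w; rewrite dF0.
apply: filterE => h /=.
by rewrite (W0 (_ - _)) normr0 mulr_ge0// ltW.
Qed.

(** * Boundary points of a convex body on lines near [xs] *)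

Section ConvexBoundary.
Variables (R : realType) (n : nat) (A : set 'rV[R]_n).
Hypotheses (clA : closed A) (cvA : convex_set A).
Variables (xs y0 : 'rV[R]_n) (r : R).
Hypotheses (bdA : bd A xs) (r0 : 0 < r).
Hypothesis ballA : forall w, enorm (w - y0) <= r -> A w.
Local Notation e := (y0 - xs).

Lemma bd_in : A xs.
Proof. by case: bdA => + _; rewrite -((closure_id A).1 clA). Qed.

(** By convexity the homothety of centre [w0] and ratio [l] maps the ball into [A]; [z] is the
    preimage of [w]. *)
Lemma ball_homothety w0 l w : A w0 -> 0 < l -> l <= 1 ->
  enorm (w - (l *: y0 + (1 - l) *: w0)) <= l * r -> A w.
Proof.
move=> Aw0 l0 l1 wr; pose z := y0 + l^-1 *: (w - (l *: y0 + (1 - l) *: w0)).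
have -> : w = l *: z + (1 - l) *: w0.
  rewrite /z scalerDr scalerA divff ?gt_eqF// scale1r.
  by apply/rowP => i; rewrite !mxE; ring.
apply: convex_comb => //; last by rewrite (ltW l0).
apply: ballA; rewrite /z addrC addKr enormZ gtr0_norm ?invr_gt0//.
by rewrite mulrC ler_pdivrMr// mulrC.
Qed.

(** On the line [s |-> xs + t (u + s e)] the parameter [S] gives a point of [A] and [- S] a point
    outside, so the boundary is met in between. As [S] does not depend on [t], the correction [s]
    stays bounded when [t] tends to 0. *)
Lemma bd_along u : exists2 S, 0 < S & forall t, 0 < t -> t * S <= 1 ->
  exists2 s, `|s| <= S & bd A (xs + t *: (u + s *: e)).
Proof.
pose S := enorm u / r + 1.
have ur0 : 0 <= enorm u / r by rewrite divr_ge0 ?enorm_ge0// ltW.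
have S0 : 0 < S by rewrite ltr_pwDr.
have uS : enorm u / S < r.
  rewrite ltr_pdivrMr// /S mulrDr mulr1 mulrC divfK ?gt_eqF//.
  by rewrite ltrDl.
have Axs := bd_in.
exists S => // t t0 tS; pose p s := xs + t *: (u + s *: e).
have tS0 : 0 < t * S by rewrite mulr_gt0.
have pS : A (p S).
  have -> : p S = (t * S) *: (y0 + S^-1 *: u) + (1 - t * S) *: xs.
    rewrite /p; apply/rowP => i; rewrite !mxE.
    by field; rewrite gt_eqF.
  apply: convex_comb => //; last by rewrite (ltW tS0).
  apply: ballA; rewrite addrC addKr enormZ gtr0_norm ?invr_gt0//.
  by rewrite mulrC ltW.
have pNS : ~ A (p (- S)).
  move=> ApS; case: bdA => _; apply; apply/nbhs_enormP.
  (* This weight solves [l = (1 - l) t S], which cancels the components along [e]: [xs] is then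
     within [l |u| / S < l r] of [l y0 + (1 - l) p (- S)], hence interior. *)
  pose l := t * S / (1 + t * S).
  have tS1 : 0 < 1 + t * S by rewrite addr_gt0.
  have l0 : 0 < l by rewrite divr_gt0.
  have l1 : l <= 1 by rewrite ler_pdivrMr// mul1r lerDr.
  have lE : l = (1 - l) * (t * S).
    by rewrite /l; field; rewrite gt_eqF.
  exists (l * (r - enorm u / S)) => [|w wxs]; first by rewrite mulr_gt0// subr_gt0.
  apply: (ball_homothety ApS l0 l1); set c := (X in w - X).
  have xsc : xs - c = - (l / S *: u).
    have -> : l / S = (1 - l) * t by rewrite {1}lE mulrA mulfK ?gt_eqF.
    rewrite /c /p; apply/rowP => i; rewrite !mxE.
    move: lE; set tt := t * S => lE.
    have -> : (1 - l) * (xs ord0 i + t * (u ord0 i + - S * (y0 ord0 i - xs ord0 i)))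
     = (1 - l) * xs ord0 i + (1 - l) * t * u ord0 i
       - ((1 - l) * tt) * (y0 ord0 i - xs ord0 i) by rewrite /tt; ring.
    by rewrite -lE; ring.
  rewrite (le_trans (enorm_tri w xs c))// xsc enormN enormZ.
  rewrite gtr0_norm ?divr_gt0//; move: wxs; rewrite mulrBr.
  by rewrite mulrA (mulrAC l); lra.
pose E := [set s | [/\ - S <= s, s <= S & A (p s)]].
have ES : E S by split=> //; lra.
have lbE : lbound E (- S) by move=> s [].
have infE : has_inf E by split; [exists S|exists (- S)].
pose s0 := inf E; pose K := t * enorm e + 1.
have K0 : 0 < K by rewrite ltr_wpDl// mulr_ge0 ?enorm_ge0// ltW.
have pK s s' : enorm (p s - p s') <= `|s - s'| * K.
  have -> : p s - p s' = ((s - s') * t) *: e.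
    by rewrite /p; apply/rowP => i; rewrite !mxE; ring.
  rewrite enormZ normrM (gtr0_norm t0) -mulrA ler_wpM2l// /K; lra.
have Aps0 : A (p s0).
  rewrite ((closure_id A).1 clA).
  apply/closure_enormP => eps eps0.
  have [|s Es ss0] := inf_adherent (eps := eps / K) _ infE.
    by rewrite divr_gt0.
  have s0s : s0 <= s by apply: ge_inf => //; exists (- S).
  case: (Es) => _ _ Aps; exists (p s) => //; rewrite (le_trans (pK _ _))// -ler_pdivlMr//.
  rewrite ger0_norm ?subr_ge0//; move: ss0; rewrite -/s0; lra.
have s0S : s0 <= S by apply: ge_inf => //; exists (- S).
have Ss0 : - S < s0.
  rewrite lt_neqAle; apply/andP; split; last by apply: lb_le_inf => //; exists S.
  by apply/eqP => Ss0; apply: pNS; rewrite Ss0.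
exists s0; first by rewrite ler_norml s0S ltW.
split; first exact: subset_closure.
move=> /nbhs_enormP[d d0 dA].
(* If [p s0] were interior, a smaller parameter would still belong to [E]; the cap [s0 + S] keeps it
   above [- S]. *)
pose s := s0 - Num.min (d / K) (s0 + S).
have m0 : 0 < Num.min (d / K) (s0 + S) by rewrite lt_min divr_gt0//=; lra.
have Es : E s.
  have mS : Num.min (d / K) (s0 + S) <= s0 + S by rewrite ge_min lexx orbT.
  split; rewrite /s; [lra|lra|]; apply: dA.
  rewrite (le_trans (pK _ _))// -ler_pdivlMr// addrC addKr normrN gtr0_norm//.
  by rewrite ge_min lexx.
have : s0 <= s by apply: ge_inf => //; exists (- S).
by rewrite /s; lra.
Qed.

End ConvexBoundary.

Definition unit_normal (R : realType) n (A : set 'rV[R]_n) (xs v : 'rV[R]_n) :=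
  enorm v = 1 /\ forall y, A y -> dot v (y - xs) <= 0.

(** The inequalities [<unormal A (x k), y - p> <= 0] pass to the limit: [p], the projection of
    [x k], tends to [xs] by nonexpansiveness. *)
Lemma normal_limit (R : realType) n (A : set 'rV[R]_n) xs (x : nat -> 'rV[R]_n) :
  closed A -> convex_set A -> A xs ->
  (forall k, ~ A (x k)) -> (forall k, enorm (x k - xs) <= k.+1%:R^-1) ->
  exists2 v, unit_normal A xs v & forall e, 0 < e -> forall N,
    exists2 k, (N <= k)%N & enorm (unormal A (x k) - v) <= e.
Proof.
move=> clA cvA Axs nAx xk; have A0 : A !=set0 by exists xs.
have [|v v1 clv] := @sphere_cluster R n (fun k => unormal A (x k)).
  by move=> k; exact: enorm_unormal.
exists v => //; split=> // y Ay.
apply: (@le0_epsP _ _ (enorm (y - xs) + 1)) => e e0.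
have [N /= Ne] : exists N : nat, N.+1%:R^-1 <= e.
  exists (Num.truncn e^-1); rewrite invf_ple ?posrE//.
  by rewrite ltW// truncnS_gt.
have [k Nk kv] := clv _ e0 N; set nu := unormal A (x k) in kv.
set p := proj A (x k).
have pe : enorm (p - xs) <= e.
  rewrite -{1}(proj_id A0 clA Axs) (le_trans (proj_nonexp A0 clA cvA _ _))//.
  rewrite (le_trans (xk k))// (le_trans _ Ne)// lef_pV2 ?posrE//.
  by rewrite ler_nat.
have -> : dot v (y - xs) =
    dot (v - nu) (y - xs) + dot nu (y - p) + dot nu (p - xs).
  by rewrite !dotE; ring.
have h1 := dot_le (v - nu) (y - xs); have h2 := dot_le nu (p - xs).
have h3 := unormal_le A0 clA cvA (x k) Ay.
rewrite (enorm_unormal A0 clA (nAx k)) mul1r in h2.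
rewrite enormB in kv.
have : enorm (v - nu) * enorm (y - xs) <= e * enorm (y - xs).
  by rewrite ler_wpM2r ?enorm_ge0.
rewrite -/nu -/p in h3; lra.
Qed.

(** * Uniqueness and continuity of the normal at a smooth boundary point *)

Section SmoothBoundary.
Variables (R : realType) (n : nat) (A : set 'rV[R]_n).
Hypotheses (clA : closed A) (cvA : convex_set A).
Variables (xs y0 : 'rV[R]_n) (r : R).
Hypotheses (bdA : bd A xs) (r0 : 0 < r).
Hypothesis ballA : forall w, enorm (w - y0) <= r -> A w.
Local Notation e := (y0 - xs).
Variables (d k : nat) (U : set 'rV[R]_n) (F : 'rV[R]_n -> 'rV[R]_d).
Hypothesis chartF : local_chart k (bd A) xs U F.

Let Axs := bd_in clA bdA.
Let A0 : A !=set0. Proof. by exists xs. Qed.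

(** [F] vanishes at the boundary points given by [bd_along]; dividing the first-order expansion
    there by [t] leaves an arbitrarily small derivative. *)
Lemma chart_curve (u : 'rV[R]_n) (eps : R) : 0 < eps -> exists s t : R,
  [/\ 0 < t, A (xs + t *: (u + s *: e)) & `|'d F xs u + s *: 'd F xs e| <= eps].
Proof.
move=> eps0; have [S S0 Sbd] := bd_along clA cvA bdA r0 ballA u.
pose K := enorm u + S * enorm e + 1.
have Se : 0 <= S * enorm e by rewrite mulr_ge0 ?enorm_ge0// ltW.
have K0 : 0 < K by rewrite ltr_wpDl// addr_ge0 ?enorm_ge0.
have [|del del0 delP] := chart_first_order chartF bdA (e := eps / K).
  by rewrite divr_gt0.
pose t := Num.min S^-1 (del / K).
have t0 : 0 < t by rewrite lt_min invr_gt0 S0 divr_gt0.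
have tS : t * S <= 1 by rewrite -ler_pdivlMr// div1r ge_min lexx.
have tK : t * K <= del by rewrite -ler_pdivlMr// ge_min lexx orbT.
have [s sS bs] := Sbd _ t0 tS; exists s, t.
have hK : enorm (u + s *: e) <= K.
  rewrite (le_trans (enormD _ _))// enormZ /K -addrA lerD2l.
  by rewrite ler_wpDr// ler_wpM2r// enorm_ge0.
have htK : enorm (t *: (u + s *: e)) <= t * K.
  by rewrite enormZ gtr0_norm// ler_wpM2l// ltW.
split=> //; first exact: bd_in bs.
have [Uh] := delP _ (le_trans htK tK).
have -> : F (xs + t *: (u + s *: e)) = 0.
  case: chartF => _ _ _ _ MU.
  by have : (bd A `&` U) (xs + t *: (u + s *: e)) by []; rewrite MU => -[].
rewrite sub0r normrN linearZ linearD linearZ normrZ gtr0_norm// => h.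
rewrite -(ler_pM2l t0) (le_trans h)//.
have -> : t * eps = eps / K * (t * K) by field; rewrite gt_eqF.
by rewrite ler_wpM2l// ltW// divr_gt0.
Qed.

(** Otherwise [chart_curve] makes the derivative zero, so by surjectivity the target is trivial and
    all of [U] consists of boundary points; but the segment from [xs] to [y0] enters the interior
    inside [U]. *)
Lemma dF_interior : 'd F xs e != 0.
Proof.
apply/eqP => dFe.
have dFu (u : 'rV[R]_n) : 'd F xs u = 0.
  apply/eqP; rewrite -normr_le0; apply: (@le0_epsP _ _ 1) => eps eps0.
  by have [s [t [_ _]]] := chart_curve u eps0; rewrite dFe scaler0 addr0 mulr1.
case: (chartF) => oU Uxs _ surjF MU.
have W0 (w : 'rV[R]_d) : w = 0.
  by have [v <-] := surjF _ Uxs w; rewrite dFu.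
have /nbhs_enormP[rho rho0 rhoU] : nbhs xs U by exact: open_nbhs_nbhs.
pose K := enorm e + 1.
have K0 : 0 < K by rewrite ltr_wpDl// enorm_ge0.
pose t := Num.min 1 (rho / K).
have t0 : 0 < t by rewrite lt_min ltr01 divr_gt0.
have t1 : t <= 1 by rewrite ge_min lexx.
have tK : t * K <= rho by rewrite -ler_pdivlMr// ge_min lexx orbT.
pose w := t *: y0 + (1 - t) *: xs.
have Uw : U w.
  apply: rhoU; have -> : w - xs = t *: e.
    by apply/rowP => i; rewrite !mxE; ring.
  rewrite enormZ gtr0_norm// (le_trans _ tK)// ler_wpM2l ?(ltW t0)//.
  by rewrite /K lerDl.
have : (bd A `&` U) w by rewrite MU; split=> //; exact: W0.
move=> [[_ +] _]; apply; apply/nbhs_enormP; exists (t * r); first by rewrite mulr_gt0.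
by move=> z zw; apply: (ball_homothety cvA ballA Axs t0 t1).
Qed.

Section KernelOfNormal.
Variable v : 'rV[R]_n.
Hypothesis vN : unit_normal A xs v.

Lemma normal_interior : dot v e < 0.
Proof.
have [v1 vA] := vN; have : dot v (y0 + r *: v - xs) <= 0.
  by apply: vA; apply: ballA; rewrite addrC addKr enormZ v1 mulr1 gtr0_norm.
by rewrite addrAC (dotDr e) dotZr -enorm_sqr v1 expr1n mulr1; have := r0; lra.
Qed.

Let curve_slope (u : 'rV[R]_n) (eps : R) : 0 < eps -> exists2 s : R,
  dot v u + s * dot v e <= 0 & `|'d F xs u + s *: 'd F xs e| <= eps.
Proof.
move=> eps0; have [s [t [t0 At h]]] := chart_curve u eps0.
exists s => //; have := vN.2 _ At.
rewrite (addrC xs) addrK. by rewrite dotZr dotDr dotZr pmulr_rle0.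
Qed.

Lemma dF_kernel (u : 'rV[R]_n) : 'd F xs u = 0 <-> dot v u = 0.
Proof.
have ve := normal_interior; set f := 'd F xs e.
have f0 : 0 < `|f| by rewrite normr_gt0 dF_interior.
(* If [u] is in the kernel, [s] is forced to be small, so [dot v u <= 0] in the limit, and likewise
   for [- u]. If [dot v u = 0], the corrections [s] and [s'] for [u] and [- u] are both nonnegative,
   and their sum is small, so both are. *)
split=> [dFu|vu].
  suff le (w : 'rV[R]_n) : 'd F xs w = 0 -> dot v w <= 0.
    apply/eqP; rewrite eq_le le//= -oppr_le0 -dotNr le//.
    by rewrite linearN dFu oppr0.
  move=> dFw; apply: (@le0_epsP _ _ (- dot v e / `|f|)) => eps eps0.
  have [s h1] := curve_slope w eps0; rewrite dFw add0r normrZ -ler_pdivlMr// => h2.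
  have : s * - dot v e <= eps / `|f| * - dot v e.
    by rewrite ler_pM2r ?oppr_gt0// (le_trans (ler_norm _)).
  have -> : eps * (- dot v e / `|f|) = eps / `|f| * - dot v e.
    by rewrite mulrA mulrAC.
  by rewrite mulrN; lra.
apply/eqP; rewrite -normr_le0; apply: (@le0_epsP _ _ 3) => eps eps0.
have [s h1 h2] := curve_slope u eps0.
have [s' h1' h2'] := curve_slope (- u) eps0.
have s_ge0 : 0 <= s by rewrite -(ler_nM2r ve) mul0r; lra.
have s'_ge0 : 0 <= s'.
  by rewrite -(ler_nM2r ve) mul0r; move: h1'; rewrite dotNr vu; lra.
have ss' : (s + s') * `|f| <= 2 * eps.
  rewrite -(ger0_norm (addr_ge0 s_ge0 s'_ge0)) -normrZ.
  have -> : (s + s') *: f = ('d F xs u + s *: f) + ('d F xs (- u) + s' *: f).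
    by rewrite linearN scalerDl addrACA subrr add0r.
  by rewrite (le_trans (ler_normD _ _))//; lra.
have -> : 'd F xs u = ('d F xs u + s *: f) - s *: f by rewrite addrK.
rewrite (le_trans (ler_normB _ _))// normrZ (ger0_norm s_ge0).
have : s * `|f| <= (s + s') * `|f| by rewrite ler_pM2r// lerDl.
by move: h2; rewrite -/f; lra.
Qed.

End KernelOfNormal.

(** Both normals are orthogonal to the same kernel, so they are parallel; the interior direction [e]
    fixes the sign. *)
Lemma unit_normal_unique v w : unit_normal A xs v -> unit_normal A xs w -> v = w.
Proof.
move=> vN wN; have [v1 _] := vN; have [w1 _] := wN.
have vv : dot v v = 1 by rewrite -enorm_sqr v1 expr1n.
have ww : dot w w = 1 by rewrite -enorm_sqr w1 expr1n.
pose c := dot v w; pose u := w - c *: v.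
have vu : dot v u = 0 by rewrite /u dotDr dotNr dotZr vv mulr1 subrr.
have wu : dot w u = 0 by apply/(dF_kernel wN)/(dF_kernel vN).
have uu : dot u u = 0 by rewrite {1}/u dotDl dotNl dotZl vu mulr0 wu subrr.
have /subr0_eq wE : u = 0.
  by apply: enorm_eq0; rewrite enormE uu sqrtr0.
have c2 : c ^+ 2 = 1.
  by move: ww; rewrite wE dotZl dotZr vv mulr1 expr2.
have cp : 0 < c.
  have we : dot w e = c * dot v e by rewrite {1}wE dotZl.
  have := normal_interior wN; have := normal_interior vN.
  by rewrite we => ve; rewrite nmulr_llt0.
suff c1 : c = 1 by rewrite wE c1 scale1r.
apply/eqP; rewrite -subr_eq0; have /eqP : (c - 1) * (c + 1) = 0 by rewrite -subr_sqr c2 expr1n subrr.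
by rewrite mulf_eq0 (gt_eqF (_ : 0 < c + 1)) ?orbF// addr_gt0.
Qed.

Lemma unit_normal_exists : exists v, unit_normal A xs v.
Proof.
have h k' : exists x, ~ A x /\ enorm (x - xs) <= k'.+1%:R^-1.
  apply: contrapT => hn; case: bdA => _; apply; apply/nbhs_enormP.
  exists k'.+1%:R^-1; first by rewrite invr_gt0.
  by move=> w wx; apply: contrapT => nAw; apply: hn; exists w.
have [x xP] := choice h.
have [||v vN _] := @normal_limit R n A xs x clA cvA Axs.
- by move=> j; case: (xP j).
- by move=> j; case: (xP j).
by exists v.
Qed.

(** A sequence violating the claim would have a cluster normal different from [v], against
    uniqueness. *)
Lemma unormal_cvg v : unit_normal A xs v -> forall eps, 0 < eps ->
  exists2 del, 0 < del & forall x, enorm (x - xs) <= del -> ~ A x ->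
    enorm (unormal A x - v) <= eps.
Proof.
move=> vN eps eps0; apply: contrapT => hn.
have h k' : exists x, [/\ ~ A x, enorm (x - xs) <= k'.+1%:R^-1 &
    eps < enorm (unormal A x - v)].
  apply: contrapT => hk; apply: hn; exists k'.+1%:R^-1; first by rewrite invr_gt0.
  move=> w wx nAw; rewrite leNgt; apply/negP => ev.
  by apply: hk; exists w.
have [x xP] := choice h.
have [||w wN clw] := @normal_limit R n A xs x clA cvA Axs.
- by move=> j; case: (xP j).
- by move=> j; case: (xP j).
have [j _] := clw _ eps0 0%N; rewrite -(unit_normal_unique vN wN).
by case: (xP j) => _ _; rewrite ltNge => /negP.
Qed.

End SmoothBoundary.

(** * Linear regularity *)

(** The chart-free form of smoothness on which the regularity estimates and the rate rest:
    projection directions converge to [v]. *)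
Definition smooth_at (R : realType) n (A : set 'rV[R]_n) (xs v : 'rV[R]_n) :=
  [/\ closed A, convex_set A, A xs, unit_normal A xs v &
    forall eps, 0 < eps -> exists2 del, 0 < del &
      forall x, enorm (x - xs) <= del -> ~ A x -> enorm (unormal A x - v) <= eps].

Lemma smooth_at_chart (R : realType) n (A : set 'rV[R]_n) xs d k U
    (F : 'rV[R]_n -> 'rV[R]_d) :
  solid A -> closed A -> convex_set A -> bd A xs ->
  local_chart k (bd A) xs U F ->
  exists2 v, smooth_at A xs v & forall u : 'rV[R]_n, 'd F xs u = 0 <-> dot v u = 0.
Proof.
move=> [y0 /nbhs_enormP[r r0 ballA]] clA cvA bdA chartF.
have [v vN] := unit_normal_exists clA cvA bdA.
exists v; last by move=> u; exact: (dF_kernel clA cvA bdA r0 ballA chartF vN).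
split=> //; first exact: bd_in.
by move=> eps eps0; exact: (unormal_cvg clA cvA bdA r0 ballA chartF vN).
Qed.

Section Smooth.
Variables (R : realType) (n : nat) (A : set 'rV[R]_n) (xs v : 'rV[R]_n).
Hypothesis smA : smooth_at A xs v.

Let clA : closed A. Proof. by case: smA. Qed.
Let cvA : convex_set A. Proof. by case: smA. Qed.
Let A0 : A !=set0. Proof. by exists xs; case: smA. Qed.

Lemma dist_le_unormal x a : ~ A x -> A a -> dist A x <= dot (unormal A x) (x - a).
Proof.
move=> nAx Aa; have h := unormal_le A0 clA cvA x Aa.
have -> : x - a = (x - proj A x) - (a - proj A x).
  by rewrite opprB addrA subrK.
rewrite (unormalE A0 clA nAx) dotDr dotNr dotZr -enorm_sqr enorm_unormal//.
by rewrite expr1n mulr1; lra.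
Qed.

Lemma normal_le_dist x : dot v (x - xs) <= dist A x.
Proof.
have [_ _ _ [v1 vA] _] := smA; rewrite distE//.
have -> : x - xs = (x - proj A x) + (proj A x - xs) by rewrite addrA subrK.
have := dot_le v (x - proj A x); have := vA _ (projP A0 clA x).
by rewrite v1 mul1r (dotDr (x - proj A x)); lra.
Qed.

Lemma dist_le_center x : dist A x <= enorm (x - xs).
Proof. by apply: dist_le => //; case: smA. Qed.

(** A membership test: if [y] were outside, its own projection direction would be one of the tested
    [nu] and would separate [y] strictly from [a]. *)
Lemma in_near_normals eps : 0 < eps -> exists2 del, 0 < del &
  forall y a, enorm (y - xs) <= del -> A a ->
    (forall nu, enorm nu = 1 -> enorm (nu - v) <= eps -> dot nu (y - a) <= 0) ->
    A y.
Proof.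
move=> eps0; have [_ _ _ _ /(_ _ eps0)[del del0 h]] := smA.
exists del => // y a ydel Aa hnu; apply: contrapT => nAy.
have := dist_le_unormal nAy Aa.
have := hnu _ (enorm_unormal A0 clA nAy) (h _ ydel nAy).
have := dist_gt0 A0 clA nAy; lra.
Qed.

Lemma dist_along h eps : enorm h = 1 -> 0 <= dot v h -> 0 < eps ->
  exists2 del, 0 < del & forall t, 0 <= t <= del ->
    dist A (xs + t *: h) <= t * (dot v h + eps).
Proof.
move=> h1 vh eps0; have [_ _ Axs _ /(_ _ eps0)[del del0 nuP]] := smA.
exists del => // t /andP[t0 tdel].
have th : enorm (xs + t *: h - xs) <= del.
  by rewrite (addrC xs) addrK enormZ h1 mulr1 ger0_norm.
have [Ax|nAx] := pselect (A (xs + t *: h)).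
  rewrite distE// proj_id// subrr enorm0 mulr_ge0// addr_ge0// ltW//.
rewrite (le_trans (dist_le_unormal nAx Axs))// (addrC xs) addrK dotZr.
rewrite ler_wpM2l//; have := nuP _ th nAx; set nu := unormal A _ => nuv.
have := dot_le (nu - v) h; rewrite h1 mulr1 dotDl dotNl addrC in nuv *.
lra.
Qed.

End Smooth.

(** * The regularity modulus in terms of the two normals *)

Section LinearRegularity.
Variables (R : realType) (n : nat) (A B : set 'rV[R]_n) (xs vA vB : 'rV[R]_n).
Hypotheses (smA : smooth_at A xs vA) (smB : smooth_at B xs vB).

Let AB0 : (A `&` B) !=set0.
Proof. by exists xs; split; [case: smA|case: smB]. Qed.

Let clAB : closed (A `&` B).
Proof. by apply: closedI; [case: smA|case: smB]. Qed.

(* The point [x - kh D h], with [D] the larger distance, lies in both sets,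
   because it is below the supporting half-spaces of each of them. *)
Lemma lin_regular_direction h kh : 0 < kh -> enorm h = 1 ->
  1 < kh * dot vA h -> 1 < kh * dot vB h -> lin_regular_with A B xs kh.
Proof.
move=> kh0 h1 kA kB; split=> //.
have step (C : set 'rV[R]_n) (v : 'rV[R]_n) : smooth_at C xs v -> 1 < kh * dot v h ->
    exists2 del, 0 < del & forall x D, enorm (x - xs) <= del ->
      dist C x <= D -> D <= enorm (x - xs) -> C (x - (kh * D) *: h).
  move=> smC kC; have [clC cvC Cxs _ _] := smC.
  have C0 : C !=set0 by exists xs.
  have [|del del0 hdel] := in_near_normals smC (eps := dot v h - kh^-1).
    by rewrite subr_gt0 -(ltr_pM2l kh0) divff// gt_eqF.
  have k10 : 0 < 1 + kh by rewrite addr_gt0.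
  exists (del / (1 + kh)) => [|x D xd CD DE]; first by rewrite divr_gt0.
  have D0 : 0 <= D by rewrite (le_trans _ CD)// dist_ge0.
  apply: (hdel _ (proj C x)); [|exact: projP|].
    rewrite addrAC (le_trans (enormD _ _))// enormN enormZ h1 mulr1.
    rewrite ger0_norm ?mulr_ge0 ?(ltW kh0)//.
    move: xd; rewrite ler_pdivlMr// => xd.
    have : kh * D <= kh * enorm (x - xs) by rewrite ler_pM2l.
    by move: xd; set E := enorm _; lra.
  move=> nu nu1 nuv; rewrite addrAC dotDr dotNr dotZr.
  have h2 := dot_le nu (x - proj C x); rewrite nu1 mul1r -distE// in h2.
  have h3 := dot_le (v - nu) h; rewrite h1 mulr1 enormB dotDl dotNl in h3.
  have h4 : 1 <= kh * dot nu h.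
    by rewrite -ler_pdivrMl// mulr1; lra.
  have : D * 1 <= D * (kh * dot nu h) by rewrite ler_wpM2l.
  by move: h2; rewrite mulr1; lra.
have [dA dA0 hA] := step A vA smA kA; have [dB dB0 hB] := step B vB smB kB.
exists (Num.min dA dB); split; first by rewrite lt_min dA0.
move=> x; rewrite le_min => /andP[xA xB].
set D := Num.max (dist A x) (dist B x).
have DE : D <= enorm (x - xs).
  by rewrite ge_max !(dist_le_center smA, dist_le_center smB).
have AD : dist A x <= D by rewrite le_max lexx.
have BD : dist B x <= D by rewrite le_max lexx orbT.
have D0 : 0 <= D.
  by rewrite (le_trans _ AD)// dist_ge0; [|exists xs|]; case: smA.
have yAB : (A `&` B) (x - (kh * D) *: h) by split; [exact: hA|exact: hB].
rewrite (le_trans (dist_le AB0 clAB x yAB))// opprB addrC subrK enormZ h1 mulr1.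
by rewrite ger0_norm// mulr_ge0// ltW.
Qed.

(** Test points leave [xs] along the bisector [h] of the normals. Both normals are nonpositive on
    the intersection, so [xs + t h] has distance at least [t] from it, while each set is within
    [t (N / 2 + eps)]. *)
Lemma lin_regular_lower kh : 0 < enorm (vA + vB) ->
  lin_regular_with A B xs kh -> 2 / enorm (vA + vB) <= kh.
Proof.
set N := enorm _ => N0 [kh0 [del [del0 reg]]].
have [_ _ _ [vA1 vAP] _] := smA; have [_ _ _ [vB1 vBP] _] := smB.
have vvA : dot vA vA = 1 by rewrite -enorm_sqr vA1 expr1n.
have vvB : dot vB vB = 1 by rewrite -enorm_sqr vB1 expr1n.
have N2 : N ^+ 2 = 2 * (1 + dot vA vB).
  by rewrite enorm_sqr !dotE vvA vvB (dotC vB vA); ring.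
pose h := N^-1 *: (vA + vB).
have h1 : enorm h = 1.
  by rewrite enormZ gtr0_norm ?invr_gt0// mulVf// gt_eqF.
have hA : dot vA h = N / 2.
  have -> : dot vA h = N ^+ 2 / 2 / N.
    by rewrite N2 /h dotZr dotDr vvA; field; rewrite gt_eqF.
  by field; rewrite gt_eqF.
have hB : dot vB h = N / 2.
  have -> : dot vB h = N ^+ 2 / 2 / N.
    by rewrite N2 /h dotZr dotDr vvB (dotC vB vA); field; rewrite gt_eqF.
  by field; rewrite gt_eqF.
have N20 : 0 <= N / 2 by rewrite divr_ge0// ltW.
suff : 1 - kh * (N / 2) <= 0.
  by rewrite ler_pdivrMr//; lra.
apply: (@le0_epsP _ _ kh) => eps eps0.
have [|dA dA0 hdA] := dist_along smA h1 _ eps0; first by rewrite hA.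
have [|dB dB0 hdB] := dist_along smB h1 _ eps0; first by rewrite hB.
pose t := Num.min del (Num.min dA dB).
have t0 : 0 < t by rewrite !lt_min del0 dA0.
have td : t <= del by rewrite ge_min lexx.
have tA : t <= dA by rewrite !ge_min lexx orbT.
have tB : t <= dB by rewrite !ge_min lexx !orbT.
have lb : t <= dist (A `&` B) (xs + t *: h).
  rewrite distE//; have [pA pB] := projP AB0 clAB (xs + t *: h).
  set p := proj _ _ in pA pB *.
  have := dot_le h (xs + t *: h - p); rewrite h1 mul1r; apply: le_trans.
  have -> : xs + t *: h - p = t *: h - (p - xs).
    by rewrite opprB addrCA addrA addrC addrA addrAC.
  rewrite dotDr dotNr dotZr -enorm_sqr h1 expr1n mulr1 lerBrDr gerDl.
  rewrite dotZl mulr_ge0_le0 ?invr_ge0 ?(ltW N0)// dotDl.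
  by have := vAP _ pA; have := vBP _ pB; lra.
have := reg (xs + t *: h); rewrite {1}(addrC xs) addrK enormZ h1 mulr1 gtr0_norm//.
move=> /(_ td) /(le_trans lb) reg'.
have : t <= kh * (t * (N / 2 + eps)).
  rewrite (le_trans reg')// ler_pM2l// ge_max -{1}hA -hB.
  by rewrite hdA ?hdB// (ltW t0).
rewrite mulrCA -[leLHS]mulr1 ler_pM2l//; lra.
Qed.

Lemma reg_kappaE : 0 < enorm (vA + vB) ->
  (exists kh, lin_regular_with A B xs kh) /\
  reg_kappa A B xs = 2 / enorm (vA + vB).
Proof.
move=> N0; set N := enorm _ in N0 *.
have [_ _ _ [vA1 vAP] _] := smA; have [_ _ _ [vB1 vBP] _] := smB.
have vvA : dot vA vA = 1 by rewrite -enorm_sqr vA1 expr1n.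
have vvB : dot vB vB = 1 by rewrite -enorm_sqr vB1 expr1n.
have N2 : N ^+ 2 = 2 * (1 + dot vA vB).
  by rewrite enorm_sqr !dotE vvA vvB (dotC vB vA); ring.
have up kh : 2 / N < kh -> lin_regular_with A B xs kh.
  move=> khN; have kh0 : 0 < kh by rewrite (lt_trans _ khN)// divr_gt0.
  apply: (@lin_regular_direction (N^-1 *: (vA + vB))) => //.
  - by rewrite enormZ gtr0_norm ?invr_gt0// mulVf// gt_eqF.
  - have -> : dot vA (N^-1 *: (vA + vB)) = N ^+ 2 / 2 / N.
      by rewrite N2 dotZr dotDr vvA; field; rewrite gt_eqF.
    by move: khN; rewrite ltr_pdivrMr// expr2 mulrAC mulfK ?gt_eqF//; lra.
  - have -> : dot vB (N^-1 *: (vA + vB)) = N ^+ 2 / 2 / N.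
      by rewrite N2 dotZr dotDr vvB (dotC vB vA); field; rewrite gt_eqF.
    by move: khN; rewrite ltr_pdivrMr// expr2 mulrAC mulfK ?gt_eqF//; lra.
have ex : exists kh, lin_regular_with A B xs kh.
  by exists (2 / N + 1); apply: up; rewrite ltrDl.
split=> //; apply/eqP; rewrite eq_le; apply/andP; split.
  apply/ler_addgt0Pr => e e0; apply: ge_inf; last by apply: up; rewrite ltrDl.
  by exists (2 / N) => kh /=; exact: lin_regular_lower.
by apply: lb_le_inf => // kh /=; exact: lin_regular_lower.
Qed.

(** The foot of [x] on the common hyperplane lies in both sets, and [x] is beyond one of the two
    opposite half-spaces by exactly [|s|]. *)
Lemma lin_regular_flat del : 0 < del -> vB = - vA ->
  (forall w, dot vA w = 0 -> enorm w <= del -> (A `&` B) (xs + w)) ->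
  lin_regular_with A B xs 1.
Proof.
move=> del0 vBA flat; split=> //; exists del; split=> // x xd; rewrite mul1r.
have [_ _ _ [vA1 _] _] := smA.
have vvA : dot vA vA = 1 by rewrite -enorm_sqr vA1 expr1n.
pose s := dot vA (x - xs); pose w := x - xs - s *: vA.
have vw : dot vA w = 0.
  by rewrite /w dotDr dotNr dotZr vvA mulr1 subrr.
have wd : enorm w <= del.
  rewrite (le_trans _ xd)// -(@ler_pXn2r _ 2) ?nnegrE ?enorm_ge0// !enorm_sqr.
  have -> : dot (x - xs) (x - xs) = dot w w + s ^+ 2.
    have -> : x - xs = w + s *: vA by rewrite /w subrK.
    by move: (w) vw => z vz; rewrite !dotE (dotC z vA) vz vvA; ring.
  by rewrite lerDl sqr_ge0.
rewrite (le_trans (dist_le AB0 clAB x (flat _ vw wd)))//.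
have -> : x - (xs + w) = s *: vA.
  by rewrite /w opprD addrA opprB addrC subrK.
rewrite enormZ vA1 mulr1 le_max.
have hA := normal_le_dist smA x; have := normal_le_dist smB x.
rewrite vBA dotNl -/s => hB; rewrite -/s in hA.
by have [s0|s0] := leP 0 s; [rewrite ger0_norm// hA|rewrite ltr0_norm// hB orbT].
Qed.

End LinearRegularity.

Lemma dot_continuous (R : realType) n (f : 'rV[R]_n) : continuous (dot f).
Proof.
move=> v P /nbhs_ballP[e /= e0 h]; apply/nbhs_enormP.
have K0 : 0 < enorm f + 1 by rewrite ltr_wpDl// enorm_ge0.
exists (e / 2 / (enorm f + 1)) => [|w]; first by rewrite !divr_gt0.
rewrite ler_pdivlMr// => wv; apply: h => /=.
rewrite /ball /= -dotNr -dotDr (le_lt_trans (ndot_le _ _))// enormB.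
by have := enorm_ge0 (w - v); lra.
Qed.

(* The chart vanishes exactly where its component along ['d F xs v] does; the
   intermediate value theorem along the normal line then yields points of [M]
   above every small tangent vector. *)
Lemma flat_chart (R : realType) n d k (M : set 'rV[R]_n) xs U
    (F : 'rV[R]_n -> 'rV[R]_d) v :
  local_chart k M xs U F -> M xs -> enorm v = 1 ->
  (forall u : 'rV[R]_n, 'd F xs u = 0 <-> dot v u = 0) ->
  (forall y, M y -> dot v (y - xs) = 0) ->
  exists2 del, 0 < del & forall w, dot v w = 0 -> enorm w <= del -> M (xs + w).
Proof.
move=> chartF Mxs v1 ker Mflat.
have vv : dot v v = 1 by rewrite -enorm_sqr v1 expr1n.
pose f : 'rV[R]_d := 'd F xs v.
have f0 : 0 < enorm f.
  rewrite lt_neqAle enorm_ge0 andbT eq_sym; apply/eqP => /enorm_eq0/ker.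
  by rewrite vv => /eqP; rewrite oner_eq0.
have [_ Uxs CkF surjF MU] := chartF.
have dFE (u : 'rV[R]_n) : dot v u = 0 -> 'd F xs u = 0 by move/ker.
(* The derivative is onto with kernel the orthogonal complement of [v], so the target is the line
   spanned by [f]. *)
have spanf (z : 'rV[R]_d) : dot f z = 0 -> z = 0.
  have [u <-] := surjF _ Uxs z => fz.
  have uE : 'd F xs u = dot v u *: f.
    apply/eqP; rewrite -subr_eq0 -linearZ -linearB; apply/eqP/ker.
    by rewrite dotDr dotNr dotZr vv mulr1 subrr.
  move: fz; rewrite uE dotZr -enorm_sqr => /eqP; rewrite mulf_eq0.
  by rewrite sqrf_eq0 (gt_eqF f0) orbF => /eqP ->; rewrite scale0r.
have d1 : 0 < (d%:R + 1 : R) by rewrite ltr_pwDr.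
(* The factor [d + 1] pays for comparing norms and 4 for a displacement of length at most [2 m]; the
   error of [g] is then half its linear value at [s = m], so [g] changes sign between [- m] and
   [m]. *)
have eps0 : 0 < enorm f / (4 * (d%:R + 1)) by rewrite divr_gt0// mulr_gt0.
have [del del0 delP] := chart_first_order chartF Mxs eps0.
exists (del / 2) => [|w vw wdel]; first by rewrite divr_gt0.
pose m := enorm w; have m0 : 0 <= m by exact: enorm_ge0.
pose p (s : R) := xs + (w + s *: v).
pose g (s : R) := dot f (F (p s)).
have small s : `|s| <= m -> enorm (w + s *: v) <= 2 * m.
  move=> sm; rewrite (le_trans (enormD _ _))// enormZ v1 mulr1 -/m; lra.
have small' s : `|s| <= m -> enorm (w + s *: v) <= del.
  by move=> /small; rewrite /m; lra.
have gE s : `|s| <= m -> `|g s - s * enorm f ^+ 2| <= enorm f ^+ 2 * m / 2.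
  move=> sm; have [_ h] := delP _ (small' _ sm).
  have -> : g s - s * enorm f ^+ 2 = dot f (F (p s) - 'd F xs (w + s *: v)).
    have -> : 'd F xs (w + s *: v) = (s *: f : 'rV[R]_d).
      by rewrite linearD linearZ dFE// add0r.
    by rewrite dotDr dotNr dotZr -enorm_sqr.
  rewrite (le_trans (ndot_le _ _))// expr2 -!mulrA ler_pM2l//.
  rewrite (le_trans (enorm_le_norm _))//.
  have : `|F (p s) - 'd F xs (w + s *: v)| <= enorm f / (4 * (d%:R + 1)) * (2 * m).
    by rewrite (le_trans h)// ler_pM2l// small.
  rewrite -(ler_pM2l d1) => /le_trans; apply.
  rewrite le_eqVlt; apply/orP; left; apply/eqP; field; rewrite gt_eqF//.
have cg : {within `[- m, m], continuous g}.
  apply: continuous_in_subspaceT => s; rewrite inE /= in_itv /= => /andP[sm ms].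
  have Ups : U (p s) by have [] := delP _ (small' s _); rewrite // ler_norml sm.
  have cp : {for s, continuous p}.
    apply: continuousD; first exact: cvg_cst.
    apply: continuousD; first exact: cvg_cst.
    by apply: continuousZl; exact: cvg_id.
  apply: continuous_comp; last exact: dot_continuous.
  apply: continuous_comp; first exact: cp.
  by case: (k) CkF => [|k'] /= CkF; [exact: CkF|case: CkF => CkF _; exact: CkF].
have ff : 0 <= enorm f ^+ 2 by rewrite sqr_ge0.
have ffm : 0 <= enorm f ^+ 2 * m by rewrite mulr_ge0.
have mm : - m <= m by lra.
have [|s] := IVT mm cg (v := 0).
  have := gE m; have := gE (- m); rewrite normrN (ger0_norm m0) lexx.
  move=> /(_ isT); rewrite ler_norml => /andP[_ h1].
  move=> /(_ isT); rewrite ler_norml => /andP[h2 _].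
  by rewrite ge_min le_max; apply/andP; split; apply/orP; [left|right]; lra.
rewrite in_itv /= => /andP[sm ms] /spanf Fps.
have sm' : `|s| <= m by rewrite ler_norml sm.
have [Ups _] := delP _ (small' s sm').
have [Mps _] : (M `&` U) (p s) by rewrite MU.
have s0 : s = 0.
  have := Mflat _ Mps; rewrite /p (addrC xs) addrK dotDr dotZr vw vv.
  by rewrite add0r mulr1.
by move: Mps; rewrite /p s0 scale0r addr0.
Qed.

(** * Convergence of the iteration *)

(* [z = u - r v] diagonalizes the unperturbed recursion up to a nilpotent part:
   it becomes [z+ = r^2 z], [v+ = r^2 v + 2 r z]; the weighted norm
   [v + L |z|] then contracts. *)
Lemma coupled_decay (R : realType) (r mu : R) : 0 <= r -> r ^+ 2 < mu < 1 ->
  exists2 eps, 0 < eps & forall v u : nat -> R,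
    (forall k, 0 <= v k) -> (forall k, 0 <= u k) ->
    (forall k, `|v k.+1 - (- r ^+ 2 * v k + 2 * r * u k)| <= eps * (v k + u k)) ->
    (forall k, `|u k.+1 - (- r ^+ 2 * u k + 2 * r * v k.+1)|
                 <= eps * (u k + v k.+1)) ->
    exists2 C, 0 <= C & forall k, v k + u k <= C * mu ^+ k.
Proof.
move=> r0 /andP[rmu mu1]; have r1 : r <= 1.
  by rewrite -(@ler_pXn2r _ 2)// ?nnegrE// expr1n ltW// (lt_trans rmu).
set g := r ^+ 2 in rmu *; have g0 : 0 <= g by rewrite sqr_ge0.
pose del := mu - g; have del0 : 0 < del by rewrite subr_gt0.
have del1 : del <= 1 by rewrite /del; lra.
pose L := 4 / del; have L4 : 4 <= L by rewrite ler_pdivlMr// mulrC ler_piMl.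
have Ld : L * del = 4 by rewrite /L divfK// gt_eqF.
(* The gap [del] is spent in two halves: [L = 4 / del] absorbs the nilpotent term [2 r z], and this
   [eps] makes the total error [12 L eps] equal to [del / 2]. *)
pose eps := del ^+ 2 / 96; have eps0 : 0 < eps by rewrite divr_gt0// exprn_gt0.
have eps1 : eps <= 1.
  by rewrite ler_pdivrMr// mul1r (le_trans (exprn_ile1 2 (ltW del0) del1))//; lra.
have Leps : 12 * L * eps = del / 2.
  by rewrite /eps /L; field; rewrite gt_eqF.
exists eps => // v u v0 u0 hv hu.
pose z k := u k - r * v k; pose W k := v k + L * `|z k|.
have Lz k : 0 <= L * `|z k| by rewrite mulr_ge0//; lra.
have W0 k : 0 <= W k by rewrite addr_ge0.
have zW k : `|z k| <= L * `|z k| by rewrite ler_peMl//; lra.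
have vuW k : v k + u k <= 2 * W k.
  have : u k <= `|z k| + v k.
    have -> : u k = z k + r * v k by rewrite /z subrK.
    by rewrite lerD ?ler_norm// ler_piMl.
  have := zW k; have := Lz k; rewrite /W; lra.
have Wstep k : W k.+1 <= mu * W k.
  pose e1 := v k.+1 - (- g * v k + 2 * r * u k).
  pose e2 := u k.+1 - (- g * u k + 2 * r * v k.+1).
  pose T := eps * (v k + u k).
  have e1T : `|e1| <= T by exact: hv.
  have ru : r * u k <= u k by rewrite ler_piMl.
  have gv : 0 <= g * v k by rewrite mulr_ge0.
  have v3 : v k.+1 <= 3 * (v k + u k).
    have : T <= v k + u k by rewrite ler_piMl// addr_ge0.
    have := v0 k; have := u0 k.
    by move: e1T; rewrite ler_norml /e1 => /andP[_]; lra.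
  have e2T : `|e2| <= 4 * T.
    rewrite (le_trans (hu k))// /T mulrCA ler_pM2l//.
    have := v0 k; have := u0 k; lra.
  have zE : z k.+1 = g * z k + r * e1 + e2.
    by rewrite /z /e1 /e2 /g; ring.
  have vE : v k.+1 = g * v k + 2 * r * z k + e1.
    by rewrite /z /e1 /g; ring.
  have z1 : `|z k.+1| <= g * `|z k| + 5 * T.
    rewrite zE (le_trans (ler_normD _ _))//.
    have := ler_normD (g * z k) (r * e1); 
    have -> : `|g * z k| = g * `|z k| by rewrite normrM ger0_norm.
    have -> : `|r * e1| = r * `|e1| by rewrite normrM ger0_norm.
    have : r * `|e1| <= `|e1| by rewrite ler_piMl.
    lra.
  have v1 : v k.+1 <= g * v k + 2 * `|z k| + T.
    rewrite vE; have := ler_norm e1; have := ler_norm (r * z k).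
    rewrite normrM (ger0_norm r0); have : r * `|z k| <= `|z k| by rewrite ler_piMl.
    by lra.
  have T2 : T <= 2 * (eps * W k) by rewrite /T mulrCA ler_pM2l.
  have Lz1 : L * `|z k.+1| <= g * (L * `|z k|) + 10 * (L * eps * W k).
    have : L * `|z k.+1| <= L * (g * `|z k| + 5 * T) by rewrite ler_pM2l//; lra.
    have : L * T <= L * (2 * (eps * W k)) by rewrite ler_pM2l//; lra.
    by lra.
  have ez : 2 * `|z k| <= del / 2 * W k.
    have : del / 2 * (L * `|z k|) <= del / 2 * W k.
      by rewrite ler_pM2l ?divr_gt0// /W lerDr.
    have -> : del / 2 * (L * `|z k|) = (L * del) / 2 * `|z k| by ring.
    by rewrite Ld; lra.
  have eW : eps * W k <= L * eps * W k.
    by rewrite -mulrA ler_peMl ?mulr_ge0 ?(ltW eps0)//; lra.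
  have LW : 12 * (L * eps * W k) = del / 2 * W k by rewrite -Leps; ring.
  have -> : mu = g + del by rewrite /del; ring.
  have gW : g * W k = g * v k + g * (L * `|z k|) by rewrite /W mulrDr.
  by rewrite {1}/W mulrDl gW; lra.
have Wk k : W k <= W 0%N * mu ^+ k.
  elim: k => [|k IH]; first by rewrite expr0 mulr1.
  rewrite (le_trans (Wstep k))// exprS mulrCA ler_pM2l//.
  by rewrite (le_lt_trans g0).
exists (2 * W 0%N) => [|k]; first by rewrite mulr_ge0.
by rewrite (le_trans (vuW k))// -mulrA ler_pM2l.
Qed.

(** * R-linear convergence from geometric step lengths *)

Section Sequences.
Variables (R : realType) (n : nat) (x : nat -> 'rV[R]_n) (xs : 'rV[R]_n).
Hypothesis xcvg : x @ \oo --> xs.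

Lemma cvg_enorm e : 0 < e -> exists N, forall k, (N <= k)%N -> enorm (x k - xs) <= e.
Proof.
move=> e0; have [|N _ hN] := xcvg (_ : nbhs xs [set w | enorm (w - xs) <= e]).
  by apply/nbhs_enormP; exists e.
by exists N => k Nk; exact: (hN k Nk).
Qed.

Lemma geometric_tail mu D N : 0 < mu < 1 -> 0 <= D ->
  (forall k, (N <= k)%N -> enorm (x k.+1 - x k) <= D * mu ^+ k) ->
  exists C, 0 < C /\ forall k, enorm (x k - xs) <= C * mu ^+ k.
Proof.
move=> /andP[mu0 mu1] D0 step; have mu1' : 0 < 1 - mu by rewrite subr_gt0.
have muk k : 0 < mu ^+ k by rewrite exprn_gt0.
pose C1 := D / (1 - mu); have C10 : 0 <= C1 by rewrite divr_ge0// ltW.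
have tail k m : (N <= k)%N -> enorm (x k - x (k + m)%N) <= C1 * (mu ^+ k - mu ^+ (k + m)).
  move=> Nk; elim: m => [|m IH]; first by rewrite addn0 !subrr enorm0 mulr0.
  rewrite (le_trans (enorm_tri _ (x (k + m)%N) _))// addnS.
  have := step _ (leq_trans Nk (leq_addr m k)); rewrite enormB => h.
  have -> : C1 * (mu ^+ k - mu ^+ (k + m).+1) =
      C1 * (mu ^+ k - mu ^+ (k + m)) + D * mu ^+ (k + m).
    rewrite exprS /C1; field; rewrite gt_eqF//.
  by rewrite lerD.
have late k : (N <= k)%N -> enorm (x k - xs) <= C1 * mu ^+ k.
  move=> Nk; apply/ler_addgt0Pr => e e0; have [N' hN'] := cvg_enorm e0.
  rewrite (le_trans (enorm_tri _ (x (k + N')%N) _))// lerD ?hN' ?leq_addl//.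
  by rewrite (le_trans (tail _ _ Nk))// ler_wpM2l// gerBl ltW.
(* This constant absorbs the finitely many indices before [N]. *)
pose C2 := \sum_(i < N) enorm (x i - xs) / mu ^+ i.
have C20 : 0 <= C2.
  by apply: sumr_ge0 => i _; rewrite divr_ge0 ?enorm_ge0// ltW.
exists (C1 + C2 + 1); split=> [|k]; first by rewrite ltr_wpDl// addr_ge0.
have [Nk|kN] := leqP N k.
  by rewrite (le_trans (late _ Nk))// ler_pM2r//; lra.
rewrite -ler_pdivrMr// (@le_trans _ _ C2)//; last by lra.
rewrite /C2 (bigD1 (Ordinal kN))//= lerDl sumr_ge0// => i _.
by rewrite divr_ge0 ?enorm_ge0// ltW.
Qed.

End Sequences.

(** * A single relaxed projection near the limit *)

Section RelaxedProjection.
Variables (R : realType) (n : nat) (A : set 'rV[R]_n) (xs v : 'rV[R]_n).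
Hypothesis smA : smooth_at A xs v.
Variable a : R.
Hypotheses (a1 : 1 <= a) (a2 : a <= 2).

Let clA : closed A. Proof. by case: smA. Qed.
Let cvA : convex_set A. Proof. by case: smA. Qed.
Let A0 : A !=set0. Proof. by exists xs; case: smA. Qed.
Let a0 : 0 <= a. Proof. by apply: le_trans a1. Qed.

Lemma rprojE x : rproj a A x = x - a *: (x - proj A x).
Proof. by rewrite /rproj scalerBl scale1r scalerBr opprB addrAC -addrA. Qed.

Lemma rproj_in x : A x -> rproj a A x = x.
Proof. by move=> Ax; rewrite rprojE proj_id// subrr scaler0 subr0. Qed.

Lemma rproj_notin x : ~ A x -> rproj a A x = x - (a * dist A x) *: unormal A x.
Proof. by move=> nAx; rewrite rprojE unormalE// scalerA. Qed.

Lemma enorm_rproj x : enorm (rproj a A x - xs) <= 3 * enorm (x - xs).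
Proof.
rewrite rprojE addrAC (le_trans (enormD _ _))// enormN enormZ ger0_norm// -distE//.
have := dist_le_center smA x; have := dist_ge0 A0 clA x => d0 d1.
have : a * dist A x <= 2 * dist A x by rewrite ler_wpM2r.
by lra.
Qed.

(* Over-relaxation lands in [A] because the projection normals near [xs] make
   an acute angle with each other. *)
Lemma rproj_mem : exists2 del, 0 < del &
  forall x, enorm (x - xs) <= del -> A (rproj a A x).
Proof.
have q0 : 0 < 4^-1 :> R by rewrite invr_gt0.
have [d1 d10 h1] := in_near_normals smA q0.
have [_ _ _ _ /(_ _ q0)[d2 d20 h2]] := smA.
exists (Num.min (d1 / 3) d2); first by rewrite lt_min d20 divr_gt0.
move=> x; rewrite le_min ler_pdivlMr// => /andP[xd1 xd2].
have [Ax|nAx] := pselect (A x); first by rewrite rproj_in.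
apply: (h1 _ (proj A x)); [|exact: projP|].
  by rewrite (le_trans (enorm_rproj _))// mulrC.
move=> nu nu1 nuv; have nu2v := h2 _ xd2 nAx; set nu2 := unormal A x in nu2v *.
have nu21 : enorm nu2 = 1 by exact: enorm_unormal.
have -> : rproj a A x - proj A x = (1 - a) *: (dist A x *: nu2).
  by rewrite -unormalE// rprojE addrAC scalerBl scale1r.
rewrite 2!dotZr mulr_le0_ge0 ?subr_le0// mulr_ge0 ?dist_ge0//.
have h3 := enorm_tri nu2 v nu; rewrite (enormB v) in h3.
have := dot_le nu (nu - nu2); rewrite nu1 mul1r dotDr dotNr -enorm_sqr nu1 expr1n.
by rewrite (enormB nu nu2); lra.
Qed.

(** Here [y] is reached from [x] by a relaxed step along the normal of [A], then one along a
    direction [om] of the other set. With [p], [q] the projections and [nu], [nu2] the normals at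
    [x], [y], the new distance is [<nu2, y - p> - <nu2, q - p>]. The first term gives the recursion;
    the second is small since [<nu, q - p> <= 0 <= <nu2, q - p>] and [nu2] is close to [nu]. *)
Lemma dist_step w eps x y om u : 0 <= u ->
  ~ A x -> ~ A y -> enorm om = 1 ->
  enorm (unormal A x - v) <= eps -> enorm (unormal A y - v) <= eps ->
  enorm (om - w) <= eps ->
  x - y = (a * dist A x) *: unormal A x + (a * u) *: om ->
  `|dist A y - (- (a - 1) * dist A x + - (a * dot v w) * u)|
    <= 8 * eps * (dist A x + u).
Proof.
move=> u0 nAx nAy om1 xv yv omw xyE; have [_ _ _ [v1 _] _] := smA.
have [nu nuE] : exists nu, unormal A x = nu by eexists.
have [nu2 nu2E] : exists nu, unormal A y = nu by eexists.
have [p pE] : exists p, proj A x = p by eexists.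
have [q qE] : exists q, proj A y = q by eexists.
have [d dE] : exists d, dist A x = d by eexists.
have d0 : 0 <= d by rewrite -dE; exact: dist_ge0.
have nu1 : enorm nu = 1 by rewrite -nuE; exact: enorm_unormal.
have nu21 : enorm nu2 = 1 by rewrite -nu2E; exact: enorm_unormal.
have xpE : x - p = d *: nu by rewrite -pE -dE -nuE; exact: unormalE.
have yqE : y - q = dist A y *: nu2 by rewrite -qE -nu2E; exact: unormalE.
have nu2pq : dot nu2 (p - q) <= 0.
  by rewrite -nu2E -pE -qE; apply: unormal_le => //; exact: projP.
have nuqp : dot nu (q - p) <= 0.
  by rewrite -nuE -pE -qE; apply: unormal_le => //; exact: projP.
have qp : enorm (q - p) <= enorm (x - y).
  by rewrite -pE -qE enormB; exact: proj_nonexp.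
rewrite nuE dE in xv xyE *; rewrite nu2E in yv.
move: (dist A y) yqE => dy yqE {nuE nu2E pE qE dE}.
have nu22 : enorm (nu2 - nu) <= 2 * eps.
  have := enorm_tri nu2 v nu; rewrite (enormB v); lra.
have dyE : dy = dot nu2 (y - p) - dot nu2 (q - p).
  rewrite -dotNr -dotDr opprB addrA subrK yqE.
  by rewrite dotZr -enorm_sqr nu21 expr1n mulr1.
have E0 : 0 <= dot nu2 (q - p) by rewrite -oppr_le0 -dotNr opprB.
have E1 : dot nu2 (q - p) <= 4 * eps * (d + u).
  have h2 := dot_le (nu2 - nu) (q - p); rewrite dotDl dotNl in h2.
  have h3 : enorm (q - p) <= 2 * (d + u).
    rewrite (le_trans qp)// xyE (le_trans (enormD _ _))// !enormZ nu1 om1 !mulr1.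
    by rewrite !ger0_norm ?mulr_ge0// -mulrDr ler_wpM2r// addr_ge0.
  have h4 : enorm (nu2 - nu) * enorm (q - p) <= (2 * eps) * (2 * (d + u)).
    by rewrite ler_pM ?enorm_ge0.
  by lra.
have ypE : y - p = (1 - a) * d *: nu - (a * u) *: om.
  have -> : y - p = (x - p) - (x - y) by apply/rowP => i; rewrite !mxE; ring.
  rewrite xpE xyE opprD addrA; congr (_ - _).
  by rewrite -scalerBl; congr (_ *: _); ring.
have c1 : `|dot nu2 nu - 1| <= 2 * eps.
  have -> : dot nu2 nu - 1 = dot (nu2 - nu) nu.
    by rewrite dotDl dotNl -(enorm_sqr nu) nu1 expr1n.
  by rewrite (le_trans (ndot_le _ _))// nu1 mulr1.
have c2 : `|dot nu2 om - dot v w| <= 2 * eps.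
  have -> : dot nu2 om - dot v w = dot (nu2 - v) om + dot v (om - w).
    by rewrite !dotE; ring.
  rewrite (le_trans (ler_normD _ _))//.
  have := ndot_le (nu2 - v) om; have := ndot_le v (om - w).
  by rewrite om1 v1 mulr1 mul1r; lra.
have -> : dy - (- (a - 1) * d + - (a * dot v w) * u) =
    (1 - a) * d * (dot nu2 nu - 1) - a * u * (dot nu2 om - dot v w)
    - dot nu2 (q - p).
  by rewrite dyE ypE (dotDr (_ *: nu)) (dotNr (_ *: om)) (dotZr _ nu) (dotZr _ om); ring.
rewrite (le_trans (ler_normB _ _))// (ger0_norm E0).
have h := ler_normB ((1 - a) * d * (dot nu2 nu - 1)) (a * u * (dot nu2 om - dot v w)).
have t1 : `|(1 - a) * d * (dot nu2 nu - 1)| <= d * (2 * eps).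
  rewrite normrM ler_pM// normrM (ger0_norm d0) ler_piMl//.
  by rewrite ler_norml; have := a1; have := a2; lra.
have t2 : `|a * u * (dot nu2 om - dot v w)| <= 2 * u * (2 * eps).
  by rewrite normrM ler_pM// ger0_norm ?mulr_ge0// ler_wpM2r.
have eps0 : 0 <= eps by rewrite (le_trans (enorm_ge0 _) xv).
have : 0 <= eps * d by rewrite mulr_ge0.
have : 0 <= eps * u by rewrite mulr_ge0.
by lra.
Qed.

End RelaxedProjection.

Lemma gap_rate (R : realType) n (A B : set 'rV[R]_n) (xs vA vB : 'rV[R]_n)
    (x : nat -> 'rV[R]_n) (a r mu : R) :
  smooth_at A xs vA -> smooth_at B xs vB ->
  0 <= r -> a = 1 + r ^+ 2 -> - (a * dot vA vB) = 2 * r -> r ^+ 2 < mu < 1 ->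
  (forall k, x k.+1 = rproj a A (rproj a B (x k))) -> x @ \oo --> xs ->
  exists C, 0 < C /\ forall k, enorm (x k - xs) <= C * mu ^+ k.
Proof.
move=> smA smB r0 aE acE rmu xE xcvg.
have /andP[rmu1 mu1] := rmu.
have r20 : 0 <= r ^+ 2 by rewrite sqr_ge0.
have mu0 : 0 < mu by rewrite (le_lt_trans r20).
have a1 : 1 <= a by rewrite aE lerDl.
have a2 : a <= 2 by rewrite aE; lra.
have a0 : 0 <= a by lra.
have mu01 : 0 < mu < 1 by rewrite mu0.
have [clA cvA Axs [vA1 _] nuA] := smA; have [clB cvB Bxs [vB1 _] nuB] := smB.
have A0 : A !=set0 by exists xs.
have B0 : B !=set0 by exists xs.
have [eps eps0 decay] := coupled_decay r0 rmu.
have eps80 : 0 < eps / 8 by rewrite divr_gt0.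
have [dA dA0 hA] := nuA _ eps80; have [dB dB0 hB] := nuB _ eps80.
have [dA' dA'0 hA'] := rproj_mem smA a1 a2.
have [dB' dB'0 hB'] := rproj_mem smB a1 a2.
pose del := Num.min (Num.min dA dB) (Num.min dA' dB').
have del0 : 0 < del by rewrite !lt_min dA0 dB0 dA'0.
(* The radius is [del / 3], since a relaxed projection may triple the distance to [xs]. *)
have [K hK] := cvg_enorm xcvg (divr_gt0 del0 (ltr0Sn R 2)).
pose y k := rproj a B (x k).
have yd k : (K <= k)%N -> enorm (y k - xs) <= del.
  move=> Kk; rewrite (le_trans (enorm_rproj smB a1 a2 _))//.
  by have := hK _ Kk; rewrite ler_pdivlMr// mulrC.
have xd k : (K <= k)%N -> enorm (x k - xs) <= del.
  move=> Kk; rewrite (le_trans (hK _ Kk))// ler_pdivrMr//.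
  by rewrite ler_pMr// ler1n.
have [ddA ddB ddA' ddB'] : [/\ del <= dA, del <= dB, del <= dA' & del <= dB'].
  by rewrite !ge_min !lexx !orbT.
have yB k : (K <= k)%N -> B (y k).
  by move=> Kk; apply: hB'; rewrite (le_trans (xd _ Kk)).
have xA k : (K < k)%N -> A (x k).
  case: k => // k Kk; rewrite xE; apply: hA'.
  by rewrite (le_trans (yd _ Kk)).
(* An iterate in both sets is fixed. Otherwise over-relaxation puts late [x k] in [A] and [y k] in
   [B], hence outside the other set, and all later steps are proper. *)
have [[k Akx Bkx]|never] := pselect (exists2 k, A (x k) & B (x k)).
  have const m : x (m + k)%N = x k.
    by elim: m => // m IH; rewrite addSn xE IH (rproj_in smB)// (rproj_in smA).
  apply: (geometric_tail xcvg (D := 0) (N := k) mu01) => // j kj.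
  by rewrite -(subnK kj) -addSn !const subrr enorm0 mul0r.
pose N := K.+1.
have nBx k : (N <= k)%N -> ~ B (x k).
  by move=> Nk Bx; apply: never; exists k => //; exact: xA.
have nAy k : (N <= k)%N -> ~ A (y k).
  move=> Nk Ay; apply: never; exists k.+1; rewrite xE (rproj_in smA)//.
  by apply: yB; exact: ltnW.
have xyE k : (N <= k)%N -> x k - y k = (a * dist B (x k)) *: unormal B (x k).
  by move=> Nk; rewrite /y (rproj_notin smB)//; [rewrite opprB addrC subrK|exact: nBx].
have yxE k : (N <= k)%N -> y k - x k.+1 = (a * dist A (y k)) *: unormal A (y k).
  by move=> Nk; rewrite xE (rproj_notin smA)//; [rewrite opprB addrC subrK|exact: nAy].
have nBv k : (N <= k)%N -> enorm (unormal B (x k) - vB) <= eps / 8.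
  move=> Nk; apply: hB; [|exact: nBx].
  by rewrite (le_trans (xd _ _))// ltnW.
have nAv k : (N <= k)%N -> enorm (unormal A (y k) - vA) <= eps / 8.
  move=> Nk; apply: hA; [|exact: nAy].
  by rewrite (le_trans (yd _ _))// ltnW.
have nu1B k : (N <= k)%N -> enorm (unormal B (x k)) = 1.
  by move=> Nk; apply: enorm_unormal => //; exact: nBx.
have nu1A k : (N <= k)%N -> enorm (unormal A (y k)) = 1.
  by move=> Nk; apply: enorm_unormal => //; exact: nAy.
pose v j := dist B (x (j + N)%N); pose u j := dist A (y (j + N)%N).
have Nj j : (N <= j + N)%N by rewrite leq_addl.
have e8 : 8 * (eps / 8) = eps by rewrite mulrC divfK.
have [|||j|C C0 hC] := decay v u.
- by move=> j; exact: dist_ge0.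
- by move=> j; exact: dist_ge0.
- move=> j; have -> : - r ^+ 2 = - (a - 1) by rewrite aE; ring.
  rewrite -acE dotC -e8; have Njs := Nj j.+1; rewrite addSn in Njs.
  apply: (dist_step smB a1 a2 (dist_ge0 A0 clA (y (j + N)%N)) (nBx _ (Nj j))
    (nBx _ Njs) (nu1A _ (Nj j)) (nBv _ (Nj j)) (nBv _ Njs) (nAv _ (Nj j))).
  by rewrite -xyE// -yxE// addrA subrK.
- have -> : - r ^+ 2 = - (a - 1) by rewrite aE; ring.
  rewrite -acE -e8; have Njs := Nj j.+1; rewrite addSn in Njs.
  apply: (dist_step smA a1 a2 (dist_ge0 B0 clB (x (j + N).+1)) (nAy _ (Nj j))
    (nAy _ Njs) (nu1B _ Njs) (nAv _ (Nj j)) (nAv _ Njs) (nBv _ Njs)).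
  by rewrite -xyE// -yxE// addrA subrK.
have muN : 0 < mu ^+ N by rewrite exprn_gt0.
(* The factor 2 bounds [a], and [mu ^+ N] undoes the index shift in [v] and [u]. *)
apply: (geometric_tail xcvg (D := 2 * C / mu ^+ N) (N := N) mu01).
  by rewrite divr_ge0 ?mulr_ge0// ltW.
move=> k Nk; have hk := hC (k - N)%N; rewrite /v /u subnK// in hk.
rewrite enormB -(subrKA (y k)) xyE// yxE// (le_trans (enormD _ _))//.
rewrite enormZ nu1B// mulr1 enormZ nu1A// mulr1.
have dB0' := dist_ge0 B0 clB (x k); have dA0' := dist_ge0 A0 clA (y k).
rewrite !ger0_norm ?mulr_ge0// -mulrDr.
have -> : 2 * C / mu ^+ N * mu ^+ k = 2 * (C * mu ^+ (k - N)).
  by rewrite -{1}(subnK Nk) exprD; field; rewrite gt_eqF.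
by rewrite ler_pM// addr_ge0.
Qed.

(** With [s] the square root of [kappa^2 - 1] all quantities are rational in [s], as
    [c = (1 - s^2) / (1 + s^2)]; [kappa >= sqrt 2] means [s >= 1], whence [r >= 0]. *)
Lemma gap_parameters (R : realType) (kappa c : R) : Num.sqrt 2 <= kappa ->
  kappa ^+ 2 * (1 + c) = 2 ->
  let r := (Num.sqrt (kappa ^+ 2 - 1) - 1) / (Num.sqrt (kappa ^+ 2 - 1) + 1) in
  [/\ 0 <= r, gap_alpha kappa = 1 + r ^+ 2, gap_gamma kappa = r ^+ 2 &
      - (gap_alpha kappa * c) = 2 * r].
Proof.
move=> k2 kc r.
have k0 : 0 <= kappa by rewrite (le_trans _ k2)// sqrtr_ge0.
have kk : 2 <= kappa ^+ 2.
  by rewrite -(@sqr_sqrtr _ (2 : R))// ler_pXn2r ?nnegrE ?sqrtr_ge0.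
have sE : Num.sqrt (kappa ^+ 2 - 1) ^+ 2 = kappa ^+ 2 - 1.
  by rewrite sqr_sqrtr// subr_ge0; lra.
have s1 : 1 <= Num.sqrt (kappa ^+ 2 - 1).
  by rewrite -{1}(sqrtr1 R) ler_wsqrtr//; lra.
rewrite /gap_alpha /gap_gamma {}/r.
move: (Num.sqrt _) sE s1 => s sE s1.
have s0 : 0 < s + 1 by lra.
have kE : kappa ^+ 2 = s ^+ 2 + 1 by rewrite sE subrK.
have alE : 2 * (kappa / (s + 1)) ^+ 2 = 1 + ((s - 1) / (s + 1)) ^+ 2.
  by rewrite expr_div_n kE; field; rewrite gt_eqF.
split=> //; first by rewrite divr_ge0 ?subr_ge0// ltW.
have s20 : 0 < s ^+ 2 + 1 by have := sqr_ge0 s; lra.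
have c1 : 1 + c = 2 / (s ^+ 2 + 1).
  apply: (canRL (mulfK _)); first by rewrite gt_eqF.
  by rewrite mulrC -kE.
have -> : c = 2 / (s ^+ 2 + 1) - 1 by rewrite -c1 addrC addKr.
rewrite expr_div_n kE; field; rewrite !gt_eqF//.
Qed.

Theorem theorem10 (R : realType) (n : nat) (A B : set 'rV[R]_n)
  (xs : 'rV[R]_n) (x : nat -> 'rV[R]_n) :
  solid A -> closed A -> convex_set A ->
  solid B -> closed B -> convex_set B ->
  (forall k, x k.+1 = gap_step 1 (gap_alpha (reg_kappa A B xs))
                        (gap_alpha (reg_kappa A B xs)) A B (x k)) ->
  x @ \oo --> xs ->
  bd A xs -> bd B xs ->
  regularity_assumption (bd A) (bd B) xs ->
  (exists kh : R, lin_regular_with A B xs kh) /\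
  (Num.sqrt 2 <= reg_kappa A B xs ->
   forall mu : R, gap_gamma (reg_kappa A B xs) < mu < 1 ->
   exists C : R, 0 < C /\ forall k, enorm (x k - xs) <= C * mu ^+ k).
Proof.
move=> sA clA cvA sB clB cvB xE xcvg bdA bdB.
move=> [_ [_ [k [_ [dA [dB [dAB [UA [UB [UAB [FA [FB [FAB]]]]]]]]]]]]].
move=> [chA chB chAB tan].
have [vA smA kerA] := smooth_at_chart sA clA cvA bdA chA.
have [vB smB kerB] := smooth_at_chart sB clB cvB bdB chB.
have [_ _ _ [vA1 vAP] _] := smA; have [_ _ _ [vB1 vBP] _] := smB.
(* For opposite normals the tangent condition makes the orthogonal complement of [vA] the tangent
   space of the intersection of the boundaries, which also lies in that hyperplane through [xs]. The
   modulus is then at most 1, against [kappa >= sqrt 2]. *)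
have [N0|N0] := eqVneq (enorm (vA + vB)) 0.
  have vBA : vB = - vA by move/enorm_eq0/eqP: N0; rewrite addrC addr_eq0 => /eqP.
  have [|y [yA yB]|del del0 flat] := @flat_chart _ _ _ _ _ _ _ _ vA chAB (conj bdA bdB) vA1.
  - move=> u; have : tangent_via FAB xs u <-> (tangent_via FA xs `&` tangent_via FB xs) u.
      by rewrite tan.
    rewrite /tangent_via /= => ->; split=> [[/kerA]//|vu].
    by split; [exact/kerA|apply/kerB; rewrite vBA dotNl vu oppr0].
  - have := vAP _ (bd_in clA yA); have := vBP _ (bd_in clB yB).
    by rewrite vBA dotNl; lra.
  have reg1 : lin_regular_with A B xs 1.
    apply: (lin_regular_flat smA smB del0 vBA) => w vw wdel.
    by have [wA wB] := flat _ vw wdel; split; [exact: bd_in wA|exact: bd_in wB].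
  split=> [|kappa2]; first by exists 1.
  have : reg_kappa A B xs <= 1.
    by apply: ge_inf => //; exists 0 => kh [/ltW].
  move/(le_trans kappa2); rewrite leNgt -{1}(sqrtr1 R) ltr_sqrt// ltr1n.
  by [].
have {}N0 : 0 < enorm (vA + vB) by rewrite lt_neqAle eq_sym N0 enorm_ge0.
have [ex kappaE] := reg_kappaE smA smB N0; split=> // kappa2 mu gmu.
have kc : reg_kappa A B xs ^+ 2 * (1 + dot vA vB) = 2.
  have N2 : enorm (vA + vB) ^+ 2 = 2 * (1 + dot vA vB).
    rewrite enorm_sqr !dotE -!enorm_sqr vA1 vB1 (dotC vB vA); ring.
  have -> : 1 + dot vA vB = enorm (vA + vB) ^+ 2 / 2 by rewrite N2; field.
  by rewrite kappaE; field; rewrite gt_eqF.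
have [r0 alE gaE acE] := gap_parameters kappa2 kc.
move: gmu; rewrite gaE => gmu.
apply: (gap_rate smA smB r0 alE acE gmu _ xcvg) => j.
by rewrite xE /gap_step subrr scale0r add0r scale1r.
Qed.
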